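(* Let $\mathfrak g$ be a complex semisimple Lie algebra, and let $\pi',\pi\in\varLambda^+$ be dominant weights with decompositions $\pi'=\pi'_1+\ldots+\pi'_l$ and $\pi=\pi_1+\ldots+\pi_k$ ($k,l\ge 1$) such that all partial sums $\pi'_1+\ldots+\pi'_j$ ($1\le j\le l$) and $\pi_1+\ldots+\pi_i$ ($1\le i\le k$) are dominant. Let $\omega'_j:=\mathrm{dom}_W(\pi'_j)$ and $\omega_i:=\mathrm{dom}_W(\pi_i)$, and assume that all the weights $\omega'_j$ ($j=1,\ldots,l$) and $\omega_i$ ($i=1,\ldots,k$) are minuscule. Identify $B_{\pi'}$ with the connected component of $B_{\omega'_1}\otimes\ldots\otimes B_{\omega'_l}$ whose highest weight element is $b_{\pi'}=(\pi'_1,\ldots,\pi'_l)$, and $B_\pi$ with the connected component of $B_{\omega_1}\otimes\ldots\otimes B_{\omega_k}$ whose highest weight element is $b_\pi=(\pi_1,\ldots,\pi_k)$. Let $p=(p_1,\ldots,p_k)\in B_\pi$ be such that $(b_{\pi'},p)\in\max\, B_{\pi'}\otimes B_\pi$, and let $(b_\pi,p')$, with $p'=(p'_1,\ldots,p'_l)\in B_{\pi'}$, be the image of $(b_{\pi'},p)$ under van Leeuwen's jeu de taquin (defined in the context). Then $$\sigma_{B_{\pi'},B_\pi}(b_{\pi'},p)=(b_\pi,p')\quad\text{and}\quad \sigma_{B_\pi,B_{\pi'}}(b_\pi,p')=(b_{\pi'},p),$$ where $\sigma$ denotes the commutor of Henriques and Kamnitzer.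
   Context: Notation. $\mathfrak g$ has root system $\varPhi$, simple roots $\alpha_i$ ($i\in I=\{1,\ldots,r\}$), coroots $\alpha^\vee=2\alpha/\langle\alpha,\alpha\rangle$, Weyl group $W$ with longest element $w_\circ$ and simple reflections $s_i$, weight lattice $\varLambda$ and set of dominant weights $\varLambda^+$. $\mathrm{dom}_W(\lambda)$ is the dominant element of the orbit $W\lambda$. A weight $\lambda$ is minuscule if $\langle\lambda,\alpha^\vee\rangle\in\{0,\pm1\}$ for all $\alpha\in\varPhi$. Crystals. A $\mathfrak g$-crystal is a set $B$ with maps $\mathrm{wt},\varepsilon:B\to\varLambda$ and $\widetilde f_i:B\to B\sqcup\{0\}$ ($i\in I$); put $\phi:=\mathrm{wt}+\varepsilon$, $\varepsilon_i(b):=\langle\varepsilon(b),\alpha_i^\vee\rangle$, $\phi_i(b):=\langle\phi(b),\alpha_i^\vee\rangle$, $\mathrm{wt}_i(b):=\langle\mathrm{wt}(b),\alpha_i^\vee\rangle$. Morphisms are maps commuting with all structure maps. The category of $\mathfrak g$-crystals (those of finite-dimensional representations of $\mathfrak g$) is the unique one satisfying: (A1) $\varepsilon(b),\phi(b)\in\varLambda^+$; (A2) $\widetilde f_i$ is a bijection from $\{b:\phi_i(b)>0\}$ to $\{b:\varepsilon_i(b)>0\}$, with inverse $\widetilde e_i$, and $\widetilde f_i$, $\widetilde e_i$ are $0$ elsewhere; (A3) $\mathrm{wt}(\widetilde f_i(b))=\mathrm{wt}(b)-\alpha_i$ and $\varepsilon_i(\widetilde f_i(b))=\varepsilon_i(b)+1$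 if $\widetilde f_i(b)\neq0$; (A4) for each $\lambda\in\varLambda^+$ there is an object $B_\lambda$ (the crystal of the irreducible representation of highest weight $\lambda$) having a maximum $b_\lambda$ of weight $\lambda$ for the order $\preceq$ generated by $\widetilde f_i(b)\preceq b$, and the objects are exactly the crystals isomorphic to direct sums (disjoint unions) of crystals $B_\lambda$; (A5) for all $\lambda,\mu\in\varLambda^+$ there is an inclusion of crystals $B_{\lambda+\mu}\hookrightarrow B_\lambda\otimes B_\mu$. Here $A_1\otimes\cdots\otimes A_n$ has underlying set $A_1\times\cdots\times A_n$, $\mathrm{wt}(a_1,\ldots,a_n)=\sum_j\mathrm{wt}(a_j)$, $$\varepsilon_i(a_1,\ldots,a_n)=\max_{1\le j\le n}\bigl(\varepsilon_i(a_j)-\mathrm{wt}_i(a_1)-\cdots-\mathrm{wt}_i(a_{j-1})\bigr),$$ and $\widetilde e_i$ (resp. $\widetilde f_i$) acts by applying $\widetilde e_i$ (resp. $\widetilde f_i$) to the entry $a_j$ with $j$ the smallest (resp. largest) index attaining this maximum (the result being $0$ if the entry becomes $0$). $\max\,B$ is the set of maximal elements of $(B,\preceq)$, i.e. of elements $b$ with $\widetilde e_i(b)=0$ for all $i$. Minuscule crystals. For $\lambda$ dominant minuscule, $B_\lambda$ has underlying set $W\lambda$, $\mathrm{wt}(\mu)=\mu$, $\varepsilon_i(\mu)=\max(0,-\langle\mu,\alpha_i^\vee\rangle)$, $\widetilde f_i(\mu)=\mu-\alpha_i$ if $\langle\mu,\alpha_i^\vee\rangle=1$ and $0$ otherwise,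 $\widetilde e_i(\mu)=\mu+\alpha_i$ if $\langle\mu,\alpha_i^\vee\rangle=-1$ and $0$ otherwise. The dominance of the partial sums ensures that $(\pi_1,\ldots,\pi_k)$ is a maximal element of $B_{\omega_1}\otimes\cdots\otimes B_{\omega_k}$ of weight $\pi$, so its connected component is isomorphic to $B_\pi$; similarly for $\pi'$. Commutor. Each $B_\lambda$ has a minimum $c_\lambda$, of weight $w_\circ(\lambda)$. Let $i\mapsto i^*$ be defined by $\alpha_{i^*}=-w_\circ(\alpha_i)$. Lusztig's involution $\eta_{B_\lambda}$ on $B_\lambda$ is specified by $\eta_{B_\lambda}(b_\lambda)=c_\lambda$ and $\widetilde e_i\,\eta_{B_\lambda}=\eta_{B_\lambda}\widetilde f_{i^*}$ (with $\eta_{B_\lambda}(0)=0$); on an arbitrary crystal $B$, $\eta_B$ is obtained by applying $\eta_{B_\lambda}$ to each component isomorphic to $B_\lambda$. The Henriques–Kamnitzer commutor is the crystal isomorphism $\sigma_{A,B}:A\otimes B\to B\otimes A$, $\sigma_{A,B}(a,b)=\eta_{B\otimes A}(\eta_B(b),\eta_A(a))$. Van Leeuwen's jeu de taquin (all $\omega_i,\omega'_j$ minuscule). Given $(b_{\pi'},p)\in\max\,B_{\pi'}\otimes B_\pi$ with $p=(p_1,\ldots,p_k)$, define weights $\lambda^{[i,j]}$ for $0\le i\le k$, $0\le j\le l$ as follows. Put $\lambda^{[0,j]}:=\pi'_1+\cdots+\pi'_j$ (so $\lambda^{[0,0]}=0$) and $\lambda^{[i,l]}:=\pi'+p_1+\cdots+p_i$.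 For $0\le i\le k-1$ and $0\le j\le l-1$ determine recursively (for increasing $i$, and for each $i$ for decreasing $j$) $$\lambda^{[i+1,j]}:=\mathrm{dom}_W\bigl(\lambda^{[i,j]}+\lambda^{[i+1,j+1]}-\lambda^{[i,j+1]}\bigr).$$ Put $h_{i,j}:=\lambda^{[i,j+1]}-\lambda^{[i,j]}$ and $v_{i,j}:=\lambda^{[i+1,j]}-\lambda^{[i,j]}$. Van Leeuwen proved that $h_{i,j}\in B_{\omega'_{j+1}}$, $v_{i,j}\in B_{\omega_{i+1}}$, that $(v_{0,0},\ldots,v_{k-1,0})=(\pi_1,\ldots,\pi_k)=b_\pi$, and that $p':=(h_{k,0},\ldots,h_{k,l-1})$ lies in $B_{\pi'}$ with $(b_\pi,p')\in\max\,B_\pi\otimes B_{\pi'}$. The image of $(b_{\pi'},p)$ is $(b_\pi,p')$; thus $p'_{j+1}=h_{k,j}$. The map $(b_{\pi'},p)\mapsto(b_\pi,p')$ is a weight-preserving bijection $\max\,B_{\pi'}\otimes B_\pi\to\max\,B_\pi\otimes B_{\pi'}$ whose inverse is given by the same procedure with the roles of $\pi$ and $\pi'$ exchanged. *)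

(* Defs.v *)
From HB Require Import structures.
From Stdlib Require Import Relations.
From mathcomp Require Import all_boot all_order all_algebra.
From mathcomp Require Import ring.
From mathcomp Require Import boolp classical_sets.

Set Implicit Arguments.
Unset Strict Implicit.
Unset Printing Implicit Defensive.

Import Order.TTheory GRing.Theory Num.Theory.
Local Open Scope ring_scope.

(* A reduced crystallographic root system in the Euclidean space (V, form),
   together with a base; such data are the root systems of the complex
   semisimple Lie algebras.  Any ordered field R is allowed as field of
   scalars. *)
Record root_system (R : realFieldType) (V : vectType R) := RootSystem {
  form : V -> V -> R;
  formDl : forall u v w, form (u + v) w = form u w + form v w;
  formZl : forall c u v, form (c *: u) v = c * form u v;
  formC : forall u v, form u v = form v u;
  form_gt0 : forall u, u != 0 -> 0 < form u u;
  roots : seq V;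
  roots_neq0 : 0 \notin roots;
  roots_span : <<roots>>%VS = fullv;
  roots_refl : forall a b, a \in roots -> b \in roots ->
    b - (2 * form b a / form a a) *: a \in roots;
  roots_int : forall a b, a \in roots -> b \in roots ->
    exists m : int, 2 * form b a / form a a = m%:~R;
  roots_reduced : forall (c : R) a, a \in roots -> c *: a \in roots ->
    c = 1 \/ c = -1;
  rk : nat;
  simple : 'I_rk -> V;
  simple_root : forall i, simple i \in roots;
  simple_basis : basis_of fullv [seq simple i | i <- enum 'I_rk];
  simple_pos : forall a, a \in roots -> exists c : 'I_rk -> nat,
    a = \sum_i simple i *+ c i \/ a = - \sum_i simple i *+ c i
}.

Arguments simple {R V} _ i.

Section Weights.
Context {R : realFieldType} {V : vectType R} (Phi : root_system V).
Local Notation I := 'I_(rk Phi).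

(* pairing v a is <v, a^vee>, where a^vee = 2a / <a, a>. *)
Definition pairing (v a : V) : R := 2 * form Phi v a / form Phi a a.
Definition pairingi (v : V) (i : I) : R := pairing v (simple Phi i).

Definition is_weight (v : V) : Prop :=
  forall a, a \in roots Phi -> exists m : int, pairing v a = m%:~R.

Definition dominant (v : V) : Prop :=
  is_weight v /\ forall i : I, 0 <= pairingi v i.

Definition minuscule (v : V) : Prop :=
  is_weight v /\
  forall a, a \in roots Phi -> pairing v a \in [:: 0; 1; -1].

Definition fund (i : I) : V :=
  xget 0 [set v : V | forall j : I, pairingi v j = (i == j)%:R].

(* The Weyl group is represented by words in the simple reflections. *)
Definition refl (i : I) (v : V) : V := v - pairingi v i *: simple Phi i.
Definition wact (s : seq I) (v : V) : V := foldr refl v s.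

Definition in_orbit (v u : V) : Prop := exists s : seq I, u = wact s v.

(* The orbit of a weight contains exactly one dominant element; on vectors
   whose orbit has none, domW is the identity. *)
Definition domW (v : V) : V :=
  xget v [set u : V | dominant u /\ in_orbit v u].

Definition reduced_word (s : seq I) : Prop :=
  forall t : seq I, wact t =1 wact s -> (size s <= size t)%N.
Definition longest_word (s : seq I) : Prop :=
  reduced_word s /\
  forall t : seq I, reduced_word t -> (size t <= size s)%N.
Definition w0 : V -> V := wact (xget [::] [set s : seq I | longest_word s]).

Definition star (i : I) : I :=
  odflt i [pick j : I | simple Phi j == - w0 (simple Phi i)].

Lemma refl_simple_neq0 i : form Phi (simple Phi i) (simple Phi i) != 0.
Proof.
rewrite gt_eqF ?form_gt0 //.
by apply: contraNneq (roots_neq0 Phi) => <-; exact: simple_root.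
Qed.

Lemma reflK i : involutive (refl i).
Proof.
move=> v; have si := refl_simple_neq0 i.
have E : pairingi (refl i v) i = - pairingi v i.
  rewrite /refl /pairingi /pairing formDl -scaleNr formZl.
  by field.
by rewrite {1}/refl E scaleNr opprK /refl subrK.
Qed.

Lemma wact_cat s t v : wact (s ++ t) v = wact s (wact t v).
Proof. exact: foldr_cat. Qed.

Lemma wactK s v : wact (rev s) (wact s v) = v.
Proof.
elim: s v => //= i s IHs v.
by rewrite rev_cons -cats1 wact_cat /= reflK IHs.
Qed.

Lemma in_orbit_sym v u : in_orbit v u -> in_orbit u v.
Proof. by case=> s ->; exists (rev s); rewrite wactK. Qed.

Lemma domW_in_orbit v : in_orbit (domW v) v.
Proof.
apply: in_orbit_sym; rewrite /domW.
by case: xgetP => [u _ [] //|_]; exists [::].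
Qed.

End Weights.

Arguments fund {R V} Phi i.

(* None plays the role of 0.  That wt and eps take values in the weight lattice
   and that eop i is the partial inverse of fop i is only required of the
   objects of a gcrystal_category. *)
Record crystal (R : realFieldType) (V : vectType R) (Phi : root_system V) :=
  Crystal {
    car :> Type;
    wt : car -> V;
    eps : car -> V;
    fop : 'I_(rk Phi) -> car -> option car;
    eop : 'I_(rk Phi) -> car -> option car
  }.

Section Crystals.
Context {R : realFieldType} {V : vectType R} {Phi : root_system V}.
Local Notation I := 'I_(rk Phi).
Implicit Types A B : crystal Phi.

Definition phi B (b : B) : V := wt b + eps b.
Definition wti B (i : I) (b : B) : R := pairingi (wt b) i.
Definition epsi B (i : I) (b : B) : R := pairingi (eps b) i.
Definition phii B (i : I) (b : B) : R := pairingi (phi b) i.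

Definition crystal_morphism A B (m : A -> B) : Prop :=
  [/\ forall a, wt (m a) = wt a,
      forall a, eps (m a) = eps a,
      forall i a, fop i (m a) = omap m (fop i a)
    & forall i a, eop i (m a) = omap m (eop i a)].

Definition crystal_inclusion A B (m : A -> B) : Prop :=
  crystal_morphism m /\ injective m.

Definition isomorphic A B : Prop :=
  exists m : A -> B, crystal_morphism m /\ bijective m.

Definition crystal_step B (b' b : B) : Prop := exists i, fop i b = Some b'.

Definition crystal_le B : relation B :=
  clos_refl_trans B (@crystal_step B).

Definition is_maximum B (b : B) : Prop := forall b', crystal_le b' b.
Definition is_minimum B (b : B) : Prop := forall b', crystal_le b b'.

(* Maximal elements for crystal_le, when eop i is the partial inverse of fop i. *)
Definition maximal B (b : B) : Prop := forall i, eop i b = None.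

Definition connected B : relation B :=
  clos_refl_sym_trans B (@crystal_step B).

Section Component.
Variables (B : crystal Phi) (b0 : B).
Definition component_car := {b : B | `[< connected b0 b >]}.

Definition component : crystal Phi := {|
  car := component_car;
  wt b := wt (val b);
  eps b := eps (val b);
  fop i b := obind (fun b' => insub b') (fop i (val b));
  eop i b := obind (fun b' => insub b') (eop i (val b)) |}.

Lemma component_base_subproof : `[< connected b0 b0 >].
Proof. by apply/asboolP; exact: rst_refl. Qed.

Definition component_base : component := exist _ b0 component_base_subproof.
End Component.

Definition dsum n (A : 'I_n -> crystal Phi) : crystal Phi := {|
  car := {j : 'I_n & A j};
  wt x := wt (projT2 x);
  eps x := eps (projT2 x);
  fop i x := omap (existT _ (projT1 x)) (fop i (projT2 x));
  eop i x := omap (existT _ (projT1 x)) (eop i (projT2 x)) |}.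

Section Tensor.
Variables (n : nat) (A : 'I_n -> crystal Phi).
Implicit Type a : forall j, A j.

Definition tensor_term (i : I) a (j : 'I_n) : R :=
  epsi i (a j) - \sum_(m < n | (m < j)%N) wti i (a m).

Definition tensor_attains (i : I) a (j : 'I_n) : bool :=
  [forall m, tensor_term i a m <= tensor_term i a j].

(* eop acts at the first, and fop at the last index attaining the maximum. *)
Definition tensor_first (i : I) a : option 'I_n :=
  [pick j | tensor_attains i a j
          & [forall m, tensor_attains i a m ==> (j <= m)%N]].

Definition tensor_last (i : I) a : option 'I_n :=
  [pick j | tensor_attains i a j
          & [forall m, tensor_attains i a m ==> (m <= j)%N]].

(* The maximum of the terms; 0 if n = 0. *)
Definition tensor_eps (i : I) a : R :=
  oapp (tensor_term i a) 0 (tensor_first i a).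

Definition tensor : crystal Phi := {|
  car := forall j, A j;
  wt a := \sum_j wt (a j);
  eps a := \sum_i tensor_eps i a *: fund Phi i;
  fop i a :=
    obind (fun j => omap (fun x => dfwith a x) (fop i (a j))) (tensor_last i a);
  eop i a :=
    obind (fun j => omap (fun x => dfwith a x) (eop i (a j))) (tensor_first i a)
|}.
End Tensor.

Definition tensor2 A B : crystal Phi := {|
  car := (A * B)%type;
  wt x := wt x.1 + wt x.2;
  eps x := \sum_i Num.max (epsi i x.1) (epsi i x.2 - wti i x.1) *: fund Phi i;
  fop i x := if epsi i x.1 <= epsi i x.2 - wti i x.1
             then omap (fun b => (x.1, b)) (fop i x.2)
             else omap (fun a => (a, x.2)) (fop i x.1);
  eop i x := if epsi i x.2 - wti i x.1 <= epsi i x.1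
             then omap (fun a => (a, x.2)) (eop i x.1)
             else omap (fun b => (x.1, b)) (eop i x.2) |}.

(* B_lam for lam dominant minuscule.  Each insub below succeeds, since
   mu - simple i, resp. mu + simple i, is then refl i mu. *)
Section Minuscule.
Variable lam : V.
Definition orbit_car := {mu : V | `[< in_orbit Phi lam mu >]}.

Definition minuscule_crystal : crystal Phi := {|
  car := orbit_car;
  wt mu := val mu;
  eps mu := \sum_i Num.max 0 (- pairingi (val mu) i) *: fund Phi i;
  fop i mu :=
    if pairingi (val mu) i == 1
    then (insub (val mu - simple Phi i) : option orbit_car) else None;
  eop i mu :=
    if pairingi (val mu) i == -1
    then (insub (val mu + simple Phi i) : option orbit_car) else None |}.
End Minuscule.

Section MinusculeTensor.
Variables (n : nat) (x : 'I_n -> V).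

(* The tensor product of the B_(omega_i), where omega_i = dom_W(x_i). *)
Definition minuscule_tensor : crystal Phi :=
  tensor (fun i => minuscule_crystal (domW Phi (x i))).

Lemma path_elt_subproof i : `[< in_orbit Phi (domW Phi (x i)) (x i) >].
Proof. by apply/asboolP; exact: domW_in_orbit. Qed.

Definition path_elt : minuscule_tensor :=
  fun i => exist _ (x i) (path_elt_subproof i).

(* B_pi, pi = x_1 + ... + x_n, realized as the connected component of
   (x_1, ..., x_n); path_top is its highest weight element. *)
Definition path_crystal : crystal Phi := component path_elt.
Definition path_top : path_crystal := component_base path_elt.

Definition entry (p : path_crystal) (i : 'I_n) : V := val (val p i).
End MinusculeTensor.

End Crystals.

(* The category of crystals of finite-dimensional representations: these
   conditions determine it.  gB lam is B_lam, and is meaningful only for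
   dominant lam. *)
Record gcrystal_category (R : realFieldType) (V : vectType R)
    (Phi : root_system V) := GCrystalCategory {
  gobj : crystal Phi -> Prop;
  gB : V -> crystal Phi;
  g_dominant : forall B, gobj B -> forall b : B,
    dominant Phi (eps b) /\ dominant Phi (phi b);
  g_inverse : forall B, gobj B -> forall i (b : B),
    [/\ isSome (fop i b) <-> 0 < phii i b,
        isSome (eop i b) <-> 0 < epsi i b
      & forall b', fop i b = Some b' <-> eop i b' = Some b];
  g_step : forall B, gobj B -> forall i (b b' : B), fop i b = Some b' ->
    wt b' = wt b - simple Phi i /\ epsi i b' = epsi i b + 1;
  g_highest : forall lam, dominant Phi lam ->
    gobj (gB lam) /\ (exists b : gB lam, is_maximum b /\ wt b = lam);
  g_objects : forall B, gobj B <->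
    exists (n : nat) (lam : 'I_n -> V),
      (forall j, dominant Phi (lam j)) /\
      isomorphic B (dsum (fun j => gB (lam j)));
  g_cartan : forall lam mu, dominant Phi lam -> dominant Phi mu ->
    exists m : gB (lam + mu) -> tensor2 (gB lam) (gB mu), crystal_inclusion m;
  g_tensor : forall A B, gobj A -> gobj B -> gobj (tensor2 A B)
}.

Section Commutor.
Context {R : realFieldType} {V : vectType R} {Phi : root_system V}.
Implicit Types A B : crystal Phi.

Definition lusztig_involution (C : gcrystal_category Phi)
    (eta : forall B : crystal Phi, B -> B) : Prop :=
  (forall lam, dominant Phi lam ->
     (forall b : gB C lam, is_maximum b -> is_minimum (eta (gB C lam) b)) /\
     (forall i (b : gB C lam),
        eop i (eta (gB C lam) b) =
        omap (eta (gB C lam)) (fop (star i) b))) /\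
  (forall B, gobj C B -> forall lam, dominant Phi lam ->
     forall m : gB C lam -> B, crystal_inclusion m ->
     forall b, eta B (m b) = m (eta (gB C lam) b)).

Definition commutor (eta : forall B : crystal Phi, B -> B) A B
    (x : tensor2 A B) : tensor2 B A :=
  eta (tensor2 B A) (eta B x.2, eta A x.1).

End Commutor.

(* jdt i j is the weight lambda^[i,j], see jdt_row0, jdt_last and jdt_rec. *)
Section JeuDeTaquin.
Context {R : realFieldType} {V : vectType R} (Phi : root_system V).
Variables (l k : nat) (x : 'I_l -> V) (p : 'I_k -> V).

Definition partial_sum n (y : 'I_n -> V) (j : nat) : V :=
  \sum_(m < n | (m < j)%N) y m.

(* Given row i, jdt_step computes the entry of row i+1 in column l - d; the
   last argument is its entry in column l. *)
Fixpoint jdt_step (row : nat -> V) (last : V) (d : nat) : V :=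
  if d is d'.+1 then
    domW Phi (row (l - d)%N + jdt_step row last d' - row (l - d')%N)
  else last.

Fixpoint jdt (i j : nat) : V :=
  if i is i'.+1 then
    jdt_step (jdt i') (partial_sum x l + partial_sum p i) (l - j)%N
  else partial_sum x j.

Lemma jdt_row0 j : jdt 0 j = partial_sum x j.
Proof. by []. Qed.

Lemma jdt_last i : jdt i l = partial_sum x l + partial_sum p i.
Proof.
case: i => [|i] /=; last by rewrite subnn.
by rewrite /partial_sum [X in _ + X]big1 ?addr0.
Qed.

Lemma jdt_rec i j : (j < l)%N ->
  jdt i.+1 j = domW Phi (jdt i j + jdt i.+1 j.+1 - jdt i j.+1).
Proof.
move=> ltjl /=; have -> : (l - j = (l - j.+1).+1)%N by rewrite subnSK.
rewrite [LHS]/= subnSK // !subKn //; exact: ltnW.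
Qed.

End JeuDeTaquin.

(* Main.v *)
From HB Require Import structures.
From Stdlib Require Import Relations.
From mathcomp Require Import all_boot all_order all_algebra.
From mathcomp Require Import ring lra.
From mathcomp Require Import boolp classical_sets.
Require Import Defs.

(** All letters are minuscule, so the crystals involved are components of one
    crystal of words, with concatenation as tensor product.  Lusztig's
    involution is transported to words ([etaw]); write eta for it.  For
    a highest word s ++ t, the commutor of s and t is the highest word connected
    with eta t ++ eta s.

    Three facts carry the proof.  First, s ++ t |-> eta t ++ eta s exchanges e_i
    and f_(star i), so it respects connectedness ([flip_wconn]), and it takes the
    commutor of a highest word s ++ t to eta (s ++ t) ([flip_wcommutor]).  In
    particular the commutor is an involution on highest words
    ([wcommutorK]), which gives the second equation of the theorem.

    Second, the local rule of jeu de taquin is made of raising operators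
    ([slide_raises]).  Suppose that om s is a highest word with first letter om.
    The column to the left of s is obtained from s by operators e_i, while om is
    lowered to the other horizontal edges by the same simple reflections.
    Since the sum of the two weights is constant, and minuscule weights pair
    to at most 1 with coroots, every raising of s remains a raising when a letter
    v with om s v highest is appended; then only v is raised, inside the
    stabiliser of the weight reached.  Hence s is connected with its
    slide, and the slide is highest ([slide_wconn]).

    Third, the first two facts show by induction on the number of columns that
    the commutor of x and p is read off a growth diagram
    ([wcommutor_jdt]): up to its last letter it is the commutor of x without its
    last letter and of the slide of p, and the last letter follows from the
    weight.

    To use words, every word with minuscule letters must lie in an irreducible
    crystal ([mword_embedded]).  This needs the crystal of a minuscule
    highest weight, which is determined by norms of weights ([orbit_eop],
    [minuscule_wt_inj]).  That star is an involution is forced by the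
    existence of eta ([star_surj], [starK]). *)

Set Implicit Arguments.
Unset Strict Implicit.
Unset Printing Implicit Defensive.

Import Order.TTheory GRing.Theory Num.Theory.
Local Open Scope ring_scope.

(** * Roots, weights and orbits of the Weyl group *)

Section RootGeometry.
Context {R : realFieldType} {V : vectType R} (Phi : root_system V).
Local Notation I := 'I_(rk Phi).
Local Notation alpha := (simple Phi).

Lemma formNl u v : form Phi (- u) v = - form Phi u v.
Proof. by rewrite -scaleN1r formZl mulN1r. Qed.

Lemma form0l v : form Phi 0 v = 0.
Proof. by rewrite -(scale0r 0) formZl mul0r. Qed.

Lemma formZr c u v : form Phi u (c *: v) = c * form Phi u v.
Proof. by rewrite formC formZl formC. Qed.

Lemma formDr u v w : form Phi u (v + w) = form Phi u v + form Phi u w.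
Proof. by rewrite formC formDl !(formC _ u). Qed.

Lemma pairingDl u v a : pairing Phi (u + v) a = pairing Phi u a + pairing Phi v a.
Proof. by rewrite /pairing formDl mulrDr mulrDl. Qed.

Lemma pairingZl c u a : pairing Phi (c *: u) a = c * pairing Phi u a.
Proof. by rewrite /pairing formZl !mulrA (mulrC 2). Qed.

Lemma pairingNl u a : pairing Phi (- u) a = - pairing Phi u a.
Proof. by rewrite -scaleN1r pairingZl mulN1r. Qed.

Lemma pairing0l a : pairing Phi 0 a = 0.
Proof. by rewrite -(scale0r 0) pairingZl mul0r. Qed.

Lemma pairingiD u v (i : I) : pairingi (u + v) i = pairingi u i + pairingi v i.
Proof. exact: pairingDl. Qed.
Lemma pairingiN u (i : I) : pairingi (- u) i = - pairingi u i.
Proof. exact: pairingNl. Qed.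
Lemma pairingiB u v (i : I) : pairingi (u - v) i = pairingi u i - pairingi v i.
Proof. by rewrite pairingiD pairingiN. Qed.
Lemma pairingiZ c u (i : I) : pairingi (c *: u) i = c * pairingi u i.
Proof. exact: pairingZl. Qed.
Lemma pairingi0 (i : I) : pairingi (0 : V) i = 0.
Proof. exact: pairing0l. Qed.
Lemma pairingi_sum (T : Type) (r : seq T) P (F : T -> V) (i : I) :
  pairingi (\sum_(x <- r | P x) F x) i = \sum_(x <- r | P x) pairingi (F x) i.
Proof.
by apply: (big_morph (fun v => pairingi v i)) => [u v|];
   rewrite ?pairingi0 ?pairingiD.
Qed.

Lemma form_alpha_gt0 (i : I) : 0 < form Phi (alpha i) (alpha i).
Proof.
rewrite form_gt0 //; apply: contraNneq (roots_neq0 Phi) => <-.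
exact: simple_root.
Qed.

Lemma form_alpha (i : I) u :
  2 * form Phi u (alpha i) = pairingi u i * form Phi (alpha i) (alpha i).
Proof. by rewrite /pairingi /pairing mulfVK // refl_simple_neq0. Qed.

Lemma sub_simple_neq (i : I) v : v - alpha i <> v.
Proof.
move/eqP; rewrite -subr_eq0 addrAC subrr add0r oppr_eq0 => /eqP a0.
by have := refl_simple_neq0 i; rewrite a0 form0l eqxx.
Qed.

Lemma pairing_simple_self (i : I) : pairingi (alpha i) i = 2.
Proof. by rewrite /pairingi /pairing mulfK // refl_simple_neq0. Qed.

Definition simple_tuple : (rk Phi).-tuple V := [tuple alpha i | i < rk Phi].

Lemma simple_tuple_basis : basis_of fullv simple_tuple.
Proof.
have -> : tval simple_tuple = [seq alpha i | i <- enum 'I_(rk Phi)].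
  by [].
exact: simple_basis.
Qed.

Lemma nth_simple_tuple (i : I) : simple_tuple`_i = alpha i.
Proof. by rewrite -tnth_nth tnth_mktuple. Qed.

Definition scoord (i : I) (v : V) : R := coord simple_tuple i v.

Lemma scoordD i u v : scoord i (u + v) = scoord i u + scoord i v.
Proof. exact: linearD. Qed.
Lemma scoordZ i c v : scoord i (c *: v) = c * scoord i v.
Proof. exact: linearZ. Qed.
Lemma scoordN i v : scoord i (- v) = - scoord i v.
Proof. exact: linearN. Qed.
Lemma scoord0 i : scoord i 0 = 0.
Proof. exact: linear0. Qed.
Lemma scoordMn i v n : scoord i (v *+ n) = scoord i v *+ n.
Proof. exact: linearMn. Qed.
Lemma scoord_sum i (T : Type) (r : seq T) P (F : T -> V) :
  scoord i (\sum_(x <- r | P x) F x) = \sum_(x <- r | P x) scoord i (F x).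
Proof. exact: linear_sum. Qed.

Lemma scoord_simple i j : scoord i (alpha j) = (i == j)%:R.
Proof.
rewrite /scoord -nth_simple_tuple coord_free ?(basis_free simple_tuple_basis) //.
by rewrite eq_sym.
Qed.

Lemma scoord_expand v : v = \sum_i scoord i v *: alpha i.
Proof.
rewrite {1}(coord_basis simple_tuple_basis (memvf v)).
by apply: eq_bigr => i _; rewrite nth_simple_tuple.
Qed.

Definition ht (v : V) : R := \sum_i scoord i v.

Lemma htD u v : ht (u + v) = ht u + ht v.
Proof. by rewrite /ht -big_split; apply: eq_bigr => i _; rewrite scoordD. Qed.
Lemma htZ c v : ht (c *: v) = c * ht v.
Proof. by rewrite /ht mulr_sumr; apply: eq_bigr => i _; rewrite scoordZ. Qed.
Lemma htN v : ht (- v) = - ht v.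
Proof. by rewrite -scaleN1r htZ mulN1r. Qed.
Lemma ht0 : ht 0 = 0.
Proof. by rewrite -(scale0r 0) htZ mul0r. Qed.
Lemma htMn v n : ht (v *+ n) = ht v *+ n.
Proof. by rewrite -scaler_nat htZ mulr_natl. Qed.
Lemma ht_sum (T : Type) (r : seq T) P (F : T -> V) :
  ht (\sum_(x <- r | P x) F x) = \sum_(x <- r | P x) ht (F x).
Proof. by apply: (big_morph ht htD); rewrite ht0. Qed.

Lemma ht_simple i : ht (alpha i) = 1.
Proof.
rewrite /ht (bigD1 i) //= scoord_simple eqxx big1 ?addr0 // => j /negPf ji.
by rewrite scoord_simple ji.
Qed.

(** A vector orthogonal to all simple roots is orthogonal to itself. *)
Lemma pairingi_inj u v : (forall i : I, pairingi u i = pairingi v i) -> u = v.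
Proof.
move=> uv; apply/eqP; rewrite -subr_eq0; apply/eqP; set w := u - v.
have w0 i : form Phi w (alpha i) = 0.
  have: pairingi w i = 0 by rewrite pairingiB uv subrr.
  rewrite /pairingi /pairing => /eqP.
  rewrite mulf_eq0 invr_eq0 (negPf (refl_simple_neq0 i)) orbF mulf_eq0.
  by rewrite pnatr_eq0 /= => /eqP.
have ww : form Phi w w = 0.
  rewrite {2}(scoord_expand w) formC.
  elim/big_rec: _ => [|i x _ IH]; first by rewrite form0l.
  by rewrite formDl formZl IH formC w0 mulr0 addr0.
apply/eqP/negPn/negP => /(form_gt0 Phi).
by rewrite ww ltxx.
Qed.

(** The existence of the dual basis that [fund] chooses from: by
    [pairingi_inj] the square matrix of the pairings of the simple roots has
    independent rows, so it is invertible. *)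
Lemma fund_pairing (i j : I) : pairingi (fund Phi i) j = (i == j)%:R.
Proof.
pose M : 'M[R]_(rk Phi) := \matrix_(a, b) pairingi (alpha a) b.
have vM (x : 'rV_(rk Phi)) b :
    pairingi (\sum_a x 0 a *: alpha a) b = (x *m M) 0 b.
  rewrite pairingi_sum mxE; apply: eq_bigr => a _.
  by rewrite mxE pairingiZ.
(* A dependence among the rows of M gives a vector that pairs to 0 with all
   simple roots and has a coefficient equal to 1. *)
have Mu : M \in unitmx.
  rewrite -row_free_unit; apply/row_freePn => -[a].
  case/submxP => D; rewrite row'Esub => E.
  suff: delta_mx 0 a - D *m row' a 1%:M = (0 : 'rV_(rk Phi)).
    move/rowP/(_ a); rewrite !mxE !eqxx.
    rewrite big1 ?subr0 => [/eqP|b _]; first by rewrite oner_eq0.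
    by rewrite !mxE eq_sym (negPf (neq_lift a b)) mulr0.
  set x := LHS.
  have x0 : x *m M = 0.
    rewrite mulmxBl -rowE E -mulmxA; apply/eqP; rewrite subr_eq0; apply/eqP.
    congr (_ *m _); apply/matrixP=> b c; rewrite !mxE.
    rewrite (bigD1 (lift a b)) //= !mxE eqxx mul1r big1 ?addr0 // => d /negPf db.
    by rewrite !mxE eq_sym db mul0r.
  have s0 : \sum_a x 0 a *: alpha a = 0.
    by apply: pairingi_inj => b; rewrite vM x0 mxE pairingi0.
  apply/rowP => b; rewrite [RHS]mxE -[LHS]/(x 0 b).
  have := congr1 (scoord b) s0; rewrite scoord0 scoord_sum (bigD1 b) //=.
  rewrite scoordZ scoord_simple eqxx big1 => [|c /negPf cb].
    by rewrite addr0 mulr1.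
  by rewrite scoordZ scoord_simple eq_sym cb mulr0.
suff [v Hv] : exists v : V, forall j : I, pairingi v j = (i == j)%:R.
  rewrite /fund; case: xgetP => [u _ /= -> //|/(_ v)] /=.
  by case/(_ Hv).
exists (\sum_a (row i (invmx M)) 0 a *: alpha a) => b.
by rewrite vM -row_mul mulVmx // !mxE.
Qed.

Lemma fund_sum_pairing (c : I -> R) j :
  pairingi (\sum_i c i *: fund Phi i) j = c j.
Proof.
rewrite pairingi_sum (bigD1 j) //= pairingiZ fund_pairing eqxx mulr1.
rewrite big1 ?addr0 // => i /negPf ij.
by rewrite pairingiZ fund_pairing ij mulr0.
Qed.

Lemma fund_expand v : v = \sum_i pairingi v i *: fund Phi i.
Proof. by apply: pairingi_inj => j; rewrite fund_sum_pairing. Qed.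

Lemma refl_form_adj (i : I) u v : form Phi (refl i u) v = form Phi u (refl i v).
Proof.
rewrite /refl -!scaleNr formDl formDr formZl formZr /pairingi /pairing.
rewrite (formC _ u (alpha i)) (formC _ v (alpha i)).
have := refl_simple_neq0 i.
by rewrite (formC _ (alpha i) v) => h; field.
Qed.

Lemma refl_form (i : I) u v : form Phi (refl i u) (refl i v) = form Phi u v.
Proof. by rewrite refl_form_adj reflK. Qed.

Lemma pairing_refl (i : I) u a :
  pairing Phi (refl i u) a = pairing Phi u (refl i a).
Proof. by rewrite /pairing refl_form_adj refl_form. Qed.

Lemma refl_root (i : I) a : a \in roots Phi -> refl i a \in roots Phi.
Proof. by move=> ar; apply: roots_refl => //; apply: simple_root. Qed.

Lemma refl_weight (i : I) u : is_weight Phi u -> is_weight Phi (refl i u).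
Proof. by move=> uw a ar; rewrite pairing_refl; apply/uw/refl_root. Qed.

Lemma refl_minuscule (i : I) u : minuscule Phi u -> minuscule Phi (refl i u).
Proof.
case=> uw um; split; first exact: refl_weight.
by move=> a ar; rewrite pairing_refl; apply/um/refl_root.
Qed.

Lemma wact_weight (s : seq I) u : is_weight Phi u -> is_weight Phi (wact s u).
Proof. by move=> uw; elim: s => //= i s; apply: refl_weight. Qed.

Lemma wact_minuscule (s : seq I) u : minuscule Phi u -> minuscule Phi (wact s u).
Proof. by move=> uw; elim: s => //= i s; apply: refl_minuscule. Qed.

Lemma wact_form (s : seq I) u : form Phi (wact s u) (wact s u) = form Phi u u.
Proof. by elim: s => //= i s; rewrite refl_form. Qed.

Lemma pairing_wact (s : seq I) u a :
  pairing Phi (wact s u) a = pairing Phi u (wact (rev s) a).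
Proof.
elim: s a => //= i s IH a.
by rewrite pairing_refl IH rev_cons -cats1 wact_cat.
Qed.

Lemma wact_root (s : seq I) a : a \in roots Phi -> wact s a \in roots Phi.
Proof. by move=> ar; elim: s => //= i s; apply: refl_root. Qed.

Lemma in_orbit_self (v : V) : in_orbit Phi v v.
Proof. by exists [::]. Qed.

Lemma in_orbit_trans (u v w : V) :
  in_orbit Phi u v -> in_orbit Phi v w -> in_orbit Phi u w.
Proof. by move=> [s ->] [t ->]; exists (t ++ s); rewrite wact_cat. Qed.

Lemma in_orbit_refl (i : I) (v u : V) :
  in_orbit Phi v u -> in_orbit Phi v (refl i u).
Proof. by case=> s ->; exists (i :: s). Qed.

Lemma root_weight a : a \in roots Phi -> is_weight Phi a.
Proof. by move=> ar b br; apply: roots_int. Qed.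

Lemma weightD u v : is_weight Phi u -> is_weight Phi v -> is_weight Phi (u + v).
Proof.
move=> hu hv a ar; have [m um] := hu a ar; have [n vn] := hv a ar.
by exists (m + n); rewrite pairingDl um vn rmorphD.
Qed.

Lemma weightN u : is_weight Phi u -> is_weight Phi (- u).
Proof.
move=> hu a ar; have [m um] := hu a ar.
by exists (- m); rewrite pairingNl um rmorphN.
Qed.

Lemma weight0 : is_weight Phi 0.
Proof. by move=> a _; exists 0; rewrite pairing0l. Qed.

Lemma weight_int (i : I) u :
  is_weight Phi u -> exists m : int, pairingi u i = m%:~R.
Proof. by apply; exact: simple_root. Qed.

(** The pairings of wv with the roots are those of v in another order, and they
    determine wv; so the orbit is finite and has an element of greatest
    height, which no simple reflection can raise. *)
Lemma orbit_dominant v :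
  exists u, in_orbit Phi v u /\ forall i : I, 0 <= pairingi u i.
Proof.
pose n := size (roots Phi); pose rt (a : 'I_n) := (roots Phi)`_a.
have rtr a : rt a \in roots Phi by rewrite mem_nth.
(* The function g records the order in which the pairings of v occur. *)
pose code (g : {ffun 'I_n -> 'I_n}) u :=
  in_orbit Phi v u /\ forall a, pairing Phi u (rt a) = pairing Phi v (rt (g a)).
have code_uniq g u u' : code g u -> code g u' -> u = u'.
  move=> [_ gu] [_ gu']; apply: pairingi_inj => i; rewrite /pairingi.
  have si := simple_root i.
  have lt : (index (alpha i) (roots Phi) < n)%N by rewrite index_mem.
  have -> : alpha i = rt (Ordinal lt) by rewrite /rt nth_index.
  by rewrite gu gu'.
have has_code u : in_orbit Phi v u -> exists g, code g u.
  move=> vu; case: (vu) => s us.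
  have h (a : 'I_n) : (index (wact (rev s) (rt a)) (roots Phi) < n)%N.
    by rewrite index_mem wact_root ?rtr.
  exists [ffun a => Ordinal (h a)]; split => // a.
  rewrite us pairing_wact ffunE /rt nth_index //; first by rewrite wact_root ?rtr.
pose real g := `[< exists u, code g u >].
pose pt g := xget 0 [set u | code g u]%classic.
have ptE g u : code g u -> pt g = u.
  move=> gu; rewrite /pt; case: xgetP => [w _ /= gw|/(_ u)[]//].
  exact: code_uniq gw gu.
have [g0 g0v] := has_code _ (in_orbit_self v).
have real0 : real g0 by apply/asboolP; exists v.
case: (Order.TotalTheory.arg_maxP (fun g => ht (pt g)) real0) => g rg gmax.
move/asboolP: rg => [u gu]; exists u; split; first by case: gu.
move=> i; rewrite leNgt; apply/negP => ui.
have [g' gu'] := has_code _ (in_orbit_refl i (proj1 gu)).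
have /gmax : real g' by apply/asboolP; exists (refl i u).
rewrite (ptE _ _ gu) (ptE _ _ gu') /refl htD htN htZ ht_simple mulr1 => le.
have {}le : ht u - pairingi u i <= ht u by [].
by move: le; rewrite gerDl oppr_le0 leNgt ui.
Qed.

Definition qpos (v : V) := exists c : I -> nat, v = \sum_i alpha i *+ c i.

Lemma qpos0 : qpos 0.
Proof. by exists (fun=> 0%N); rewrite big1 // => i _; rewrite mulr0n. Qed.

Lemma qposD u v : qpos u -> qpos v -> qpos (u + v).
Proof.
move=> [c ->] [d ->]; exists (fun i => c i + d i)%N; rewrite -big_split.
by apply: eq_bigr => i _; rewrite mulrnDr.
Qed.

Lemma qpos_simple i : qpos (alpha i).
Proof.
exists (fun j => (i == j) : nat); rewrite (bigD1 i) //= eqxx big1 ?addr0 //.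
by move=> j /negPf; rewrite eq_sym => ->.
Qed.

Lemma qpos_scoord v i : qpos v -> 0 <= scoord i v.
Proof.
move=> [c ->]; rewrite scoord_sum; apply: sumr_ge0 => j _.
by rewrite scoordMn scoord_simple mulrn_wge0 // ler0n.
Qed.

Lemma qpos_ht v : qpos v -> exists n : nat, ht v = n%:R.
Proof.
move=> [c ->]; exists (\sum_i c i)%N; rewrite ht_sum natr_sum.
by apply: eq_bigr => j _; rewrite htMn ht_simple.
Qed.

Lemma qpos_form v u :
  qpos v -> (forall i : I, 0 <= pairingi u i) -> 0 <= form Phi v u.
Proof.
move=> [c ->] hu.
elim/big_rec: _ => [|i x _ IH]; first by rewrite form0l.
rewrite formDl addr_ge0 // -scaler_nat formZl mulr_ge0 ?ler0n //.
have := hu i; rewrite /pairingi /pairing formC => h.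
rewrite leNgt; apply/negP => lt0; move: h; rewrite leNgt => /negP[].
have aa := form_alpha_gt0 i.
by rewrite pmulr_llt0 ?invr_gt0 // pmulr_rlt0 // formC.
Qed.

Lemma qpos_anti v : qpos v -> qpos (- v) -> v = 0.
Proof.
move=> pv nv; rewrite (scoord_expand v) big1 // => i _.
suff -> : scoord i v = 0 by rewrite scale0r.
apply/eqP; rewrite eq_le (qpos_scoord i pv) andbT -oppr_ge0 -scoordN.
exact: qpos_scoord.
Qed.

End RootGeometry.

(** * Strings, weights and extremal elements *)

Section RegularCrystals.
Context {R : realFieldType} {V : vectType R} {Phi : root_system V}.
Context (C : gcrystal_category Phi).
Local Notation I := 'I_(rk Phi).
Local Notation alpha := (simple Phi).

Section Object.
Variables (B : crystal Phi) (objB : gobj C B).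
Implicit Types (b : B) (i : I).

Lemma phiiE i b : phii i b = wti i b + epsi i b.
Proof. exact: pairingiD. Qed.

Lemma dominant_nat u i : dominant Phi u -> exists n : nat, pairingi u i = n%:R.
Proof.
move=> [uw u0]; have [m um] := weight_int i uw.
have := u0 i; rewrite um ler0z => m0.
by exists `|m|%N; rewrite -[in LHS](gez0_abs m0).
Qed.

Lemma epsi_nat i b : exists n : nat, epsi i b = n%:R.
Proof. by apply: dominant_nat; case: (g_dominant objB b). Qed.

Lemma phii_nat i b : exists n : nat, phii i b = n%:R.
Proof. by apply: dominant_nat; case: (g_dominant objB b). Qed.

Lemma epsi_ge0 i b : 0 <= epsi i b.
Proof. by have [n ->] := epsi_nat i b. Qed.

Lemma phii_ge0 i b : 0 <= phii i b.
Proof. by have [n ->] := phii_nat i b. Qed.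

Lemma fopK i b b' : fop i b = Some b' <-> eop i b' = Some b.
Proof. by have [_ _] := g_inverse objB i b; apply. Qed.

Lemma fop_none i b : fop i b = None <-> phii i b = 0.
Proof.
have [h _ _] := g_inverse objB i b; split=> [f0|p0].
  apply/eqP; rewrite eq_le phii_ge0 andbT leNgt; apply/negP => /h.
  by rewrite f0.
by case E: (fop i b) h => [b'|] // -[/(_ isT)]; rewrite p0 ltxx.
Qed.

Lemma eop_none i b : eop i b = None <-> epsi i b = 0.
Proof.
have [_ h _] := g_inverse objB i b; split=> [f0|p0].
  apply/eqP; rewrite eq_le epsi_ge0 andbT leNgt; apply/negP => /h.
  by rewrite f0.
by case E: (eop i b) h => [b'|] // -[/(_ isT)]; rewrite p0 ltxx.
Qed.

Lemma fop_data i b b' : fop i b = Some b' ->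
  [/\ wt b' = wt b - alpha i, epsi i b' = epsi i b + 1
    & phii i b' = phii i b - 1].
Proof.
move=> /(g_step objB)[w e]; split=> //.
by rewrite !phiiE e /wti w pairingiB pairing_simple_self; lra.
Qed.

Lemma wt_weight b : is_weight Phi (wt b).
Proof.
have [[e _] [p _]] := g_dominant objB b.
have -> : wt b = phi b - eps b by rewrite /phi addrK.
by apply: weightD => //; apply: weightN.
Qed.

Lemma fop_iter n i b : n%:R <= phii i b ->
  exists b', wt b' = wt b - alpha i *+ n.
Proof.
elim: n b => [|n IH] b le; first by exists b; rewrite mulr0n subr0.
case E: (fop i b) => [b1|].
  have [w _ p] := fop_data E.
  have [|b' wb] := IH b1; first by rewrite p; move: le; rewrite -natr1; lra.
  by exists b'; rewrite wb w mulrS opprD addrA.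
by move/fop_none: E => E; move: le; rewrite E lern0.
Qed.

Lemma eop_iter n i b : n%:R <= epsi i b ->
  exists b', wt b' = wt b + alpha i *+ n.
Proof.
elim: n b => [|n IH] b le; first by exists b; rewrite mulr0n addr0.
case E: (eop i b) => [b1|].
  have [w e _] := fop_data (proj2 (fopK _ _ _) E).
  have [|b' wb] := IH b1; first by move: le; rewrite e -natr1; lra.
  by exists b'; rewrite wb w mulrS addrA subrK.
by move/eop_none: E => E; move: le; rewrite E lern0.
Qed.

(** The reflection of a weight is reached by moving along the i-string. *)
Lemma wt_refl i b : exists b', wt b' = refl i (wt b).
Proof.
have [m wm] := weight_int i (wt_weight b).
have pe := phiiE i b.
case: m wm => n wn.
  have [|b' wb] := @fop_iter n i b.
    by rewrite pe /wti wn lerDl epsi_ge0.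
  by exists b'; rewrite wb /refl wn -scaler_nat.
have [|b' wb] := @eop_iter n.+1 i b.
  have := phii_ge0 i b; rewrite pe /wti wn NegzE mulrNz -[n.+1%:~R]/(n.+1%:R).
  by lra.
by exists b'; rewrite wb /refl wn NegzE mulrNz scaleNr opprK -scaler_nat.
Qed.

Lemma wt_orbit b u : in_orbit Phi (wt b) u -> exists b', wt b' = u :> V.
Proof.
case=> s ->; elim: s => [|i s [b' IH]]; first by exists b.
by have [b'' w] := wt_refl i b'; exists b''; rewrite w IH.
Qed.

Lemma crystal_le_qpos b b' : crystal_le b b' -> qpos Phi (wt b' - wt b).
Proof.
elim=> {b b'} [b b' [i /fop_data[-> _ _]]|b|b b' b'' _ h _ h'].
- by rewrite opprB addrC subrK; apply: qpos_simple.
- by rewrite subrr; apply: qpos0.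
- by have := qposD h' h; rewrite addrA subrK.
Qed.

Lemma crystal_le_anti b b' : crystal_le b b' -> crystal_le b' b -> b = b'.
Proof.
move=> le; have h := clos_rt_rt1n _ _ _ _ le; clear le.
case: h => // b1 b2 [i /fop_data[w _ _]] h le2.
have le1 := clos_rt1n_rt _ _ _ _ h.
have [n en] := qpos_ht (crystal_le_qpos le2).
have [m em] := qpos_ht (crystal_le_qpos le1).
have : n%:R + m%:R + 1 = 0 :> R.
  by rewrite -en -em !htD !htN w htD htN ht_simple; lra.
by move/eqP; rewrite -natrD natr1 pnatr_eq0.
Qed.

Lemma maximum_maximal b : is_maximum b -> maximal b.
Proof.
move=> bmax i; case E: (eop i b) => [b'|] //.
have fb := proj2 (fopK _ _ _) E.
have eb : b' = b.
  by apply: crystal_le_anti => //; apply: rt_step; exists i.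
by have [/esym] := fop_data fb; rewrite eb => /sub_simple_neq.
Qed.

Lemma minimum_fop b i : is_minimum b -> fop i b = None.
Proof.
move=> bmin; case E: (fop i b) => [b'|] //.
have eb : b' = b.
  by apply: crystal_le_anti => //; apply: rt_step; exists i.
by have [/esym] := fop_data E; rewrite eb => /sub_simple_neq.
Qed.

Lemma maximal_le b b' : maximal b -> crystal_le b b' -> b = b'.
Proof.
move=> bm le; have h := clos_rt_rt1n _ _ _ _ le; clear le.
by case: h bm => // b1 b2 [i /fopK h] _ bm; rewrite bm in h.
Qed.

Lemma minimal_le b b' : (forall i, fop i b = None) -> crystal_le b' b -> b = b'.
Proof.
move=> bm le; have h := clos_rt_rtn1 _ _ _ _ le; clear le.
by case: h bm => // b1 b2 [i h] _ bm; rewrite bm in h.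
Qed.

Lemma maximal_maximum b b' : maximal b -> is_maximum b' -> b = b'.
Proof. by move=> bm b'm; apply: maximal_le. Qed.

Lemma minimal_minimum b b' : (forall i, fop i b = None) -> is_minimum b' -> b = b'.
Proof. by move=> bm b'm; apply: minimal_le. Qed.

End Object.

Section Highest.
Variables (lam : V) (dlam : dominant Phi lam).
Local Notation L := (gB C lam).

Lemma objL : gobj C L. Proof. by case: (g_highest C dlam). Qed.

Lemma exists_top : exists b : L, is_maximum b /\ wt b = lam.
Proof. by case: (g_highest C dlam). Qed.

Lemma wt_le_top (b : L) : qpos Phi (lam - wt b).
Proof.
have [t [tm tl]] := exists_top; rewrite -{1}tl.
exact: (crystal_le_qpos objL).
Qed.

(** Inside its orbit the weight can be made dominant.  For dominant u <= lam the
    products of lam - u with u and with lam are nonnegative. *)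
Lemma wt_norm (b : L) : form Phi (wt b) (wt b) <= form Phi lam lam.
Proof.
have [u [ou u0]] := orbit_dominant Phi (wt b).
have [b' b'u] := wt_orbit objL ou.
have le := wt_le_top b'.
have -> : form Phi (wt b) (wt b) = form Phi u u.
  by case: ou => s ->; rewrite wact_form.
have h1 := qpos_form le u0.
have h2 := qpos_form le (proj2 dlam).
move: h1 h2; rewrite b'u !formDl !formNl (formC _ u lam); lra.
Qed.

End Highest.

(** Both weights occur in either of the two irreducible crystals, so each
    is below the other. *)
Lemma dominant_orbit_eq lam u :
  dominant Phi lam -> dominant Phi u -> in_orbit Phi lam u -> u = lam.
Proof.
move=> dl du lu; have ul := in_orbit_sym lu.
have [t [_ tl]] := exists_top dl; have [t' [_ tu]] := exists_top du.
rewrite -tl in lu; rewrite -tu in ul.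
have [b bu] := wt_orbit (objL dl) lu; have [b' bl] := wt_orbit (objL du) ul.
have h1 := wt_le_top dl b; have h2 := wt_le_top du b'.
rewrite bu in h1; rewrite bl in h2.
apply/esym/eqP; rewrite -subr_eq0; apply/eqP/(qpos_anti (Phi := Phi)) => //.
by rewrite opprB.
Qed.

Lemma domW_eq v u : dominant Phi u -> in_orbit Phi v u -> domW Phi v = u.
Proof.
move=> du vu; rewrite /domW; case: xgetP => [w _ /= [dw vw]|/(_ u)[]//].
by apply: dominant_orbit_eq => //; apply: in_orbit_trans (in_orbit_sym vu) vw.
Qed.

Lemma weight_orbit_dominant v : is_weight Phi v ->
  exists u, in_orbit Phi v u /\ dominant Phi u.
Proof.
move=> vw; have [u [vu u0]] := orbit_dominant Phi v; exists u; split=> //.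
by split=> //; case: vu => s ->; apply: wact_weight.
Qed.

Lemma domW_dominant v : is_weight Phi v -> dominant Phi (domW Phi v).
Proof. by case/weight_orbit_dominant=> u [vu du]; rewrite (domW_eq du vu). Qed.

End RegularCrystals.

(** * Lusztig's involution on an irreducible crystal *)

Section Lusztig.
Context {R : realFieldType} {V : vectType R} {Phi : root_system V}.
Context (C : gcrystal_category Phi).
Local Notation I := 'I_(rk Phi).
Local Notation alpha := (simple Phi).

Lemma maximum_ind (B : crystal Phi) (P : B -> Prop) (t : B) :
  is_maximum t -> P t ->
  (forall i b b', fop i b = Some b' -> P b -> P b') -> forall b, P b.
Proof.
move=> tm Pt Pf b; have h := clos_rt_rt1n _ _ _ _ (tm b).
by elim: h Pt => // x y z [i fy] _ IH /IH; apply: Pf fy.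
Qed.

(** The weight alpha_j occurs in some irreducible crystal, so some dominant
    weight lam has a positive pairing with alpha_j.  The weight eps of the
    element just below the maximum of B_lam is then fund j, and it is dominant
    by the axioms. *)
Lemma fund_dominant j : dominant Phi (fund Phi j).
Proof.
have [mu [omu dmu]] := weight_orbit_dominant (root_weight (simple_root j)).
have [t0 [_ t0w]] := exists_top C dmu.
have := in_orbit_sym omu; rewrite -{1}t0w => /(wt_orbit (objL C dmu))[b bw].
have [_ dlam] := g_dominant (objL C dmu) b.
set lam := phi b in dlam.
have lamj : 0 < pairingi lam j.
  rewrite -[pairingi lam j]/(phii j b) phiiE /wti bw pairing_simple_self.
  by rewrite ltr_wpDr // (epsi_ge0 (objL C dmu)).
have [t [tm tw]] := exists_top C dlam.
have oL := objL C dlam.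
have et i : epsi i t = 0 by apply/(eop_none oL)/(maximum_maximal oL).
have [d fd] : exists d, fop j t = Some d.
  case E: (fop j t) => [d|]; first by exists d.
  move/(fop_none oL): E; rewrite phiiE et addr0 /wti tw => E.
  by rewrite E ltxx in lamj.
have [wd ed _] := fop_data oL fd.
suff <- : eps d = fund Phi j by case: (g_dominant oL d).
apply: (pairingi_inj (Phi := Phi)) => i; rewrite fund_pairing -[LHS]/(epsi i d).
have [<-|ji] := eqVneq j i; first by rewrite ed et add0r.
apply/(eop_none oL); case E: (eop i d) => [d'|] //.
have [wd' _ _] := fop_data oL (proj2 (fopK oL _ _ _) E).
(* Raised by e_i, the element d would have the weight lam - alpha_j + alpha_i,
   which is not below lam. *)
have := qpos_scoord i (wt_le_top dlam d').
have -> : wt d' = lam - alpha j + alpha i by rewrite -[in RHS]tw -wd wd' subrK.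
rewrite scoordD scoordN scoordD scoordD scoordN !scoord_simple eqxx.
by rewrite [i == j]eq_sym (negPf ji) subr0 opprD addrA subrr add0r oppr_ge0 ler10.
Qed.

Context (eta : forall B : crystal Phi, B -> B) (Heta : lusztig_involution C eta).

Section OnIrreducible.
Variables (lam : V) (dlam : dominant Phi lam).
Local Notation L := (gB C lam).
Local Notation oL := (objL C dlam).

Lemma eta_max (b : L) : is_maximum b -> is_minimum (eta b).
Proof. by have [h _] := Heta; have [] := h _ dlam; auto. Qed.

Lemma eta_eop i (b : L) : eop i (eta b) = omap (@eta L) (fop (star i) b).
Proof. by have [h _] := Heta; have [] := h _ dlam; auto. Qed.

(** Every element is reached from the minimum eta t by raising operators. *)
Lemma eta_surj (x : L) : exists b : L, eta b = x.
Proof.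
have [t [tm _]] := exists_top C dlam.
have: crystal_le (eta t) x := eta_max tm x.
have: exists b : L, eta b = eta t by exists t.
move: (eta t) => y ey le; elim: le ey => {x y} [x y [i fy]|//|x y z _ h1 _ h2 /h1/h2//].
case=> b eb; move/(fopK oL): fy; rewrite -eb eta_eop.
by case: (fop _ b) => //= b' [<-]; exists b'.
Qed.

End OnIrreducible.

(** On B_(fund j) the only operator that acts on the maximum is f_j; were j
    not a value of star, no e_i would act on the minimum, which would then be
    the maximum. *)
Lemma star_surj (j : I) : exists i : I, star i = j.
Proof.
apply: contrapT => nj; have dj := fund_dominant j.
have oL := objL C dj; have [t [tm tw]] := exists_top C dj.
have et i : epsi i t = 0 by apply/(eop_none oL)/(maximum_maximal oL).
have cm := eta_max dj tm.
have eq_t : eta t = t.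
  apply: (maximal_maximum oL) => // i; rewrite (eta_eop dj).
  have -> // : fop (star i) t = None.
  apply/(fop_none oL); rewrite phiiE et addr0 /wti tw fund_pairing.
  by case: eqP => // ji; case: nj; exists i.
have := minimum_fop oL j cm; rewrite eq_t => /(fop_none oL).
rewrite phiiE et addr0 /wti tw fund_pairing eqxx => /eqP.
by rewrite oner_eq0.
Qed.

Section OnIrreducibleBijective.
Variables (lam : V) (dlam : dominant Phi lam).
Local Notation L := (gB C lam).
Local Notation oL := (objL C dlam).

(** Raise a common value to the maximum: both arguments are lowered at the
    same time, and they end in elements that no f_(star i) lowers, hence, star
    being surjective, in the minimum. *)
Lemma eta_inj (b1 b2 : L) : eta b1 = eta b2 -> b1 = b2.
Proof.
have [t [tm _]] := exists_top C dlam.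
move: {-1}(eta b1) (erefl (eta b1)) => x e1 /esym e2.
have h := clos_rt_rt1n _ _ _ _ (tm x).
elim: h b1 b2 e1 e2 tm => {x t} [x|x y z [i fy] _ IH] b1 b2 e1 e2 tm.
  have h b : eta b = x -> forall i, fop i b = None.
    move=> eb i; have [j <-] := star_surj i.
    have := maximum_maximal oL tm j; rewrite -eb (eta_eop dlam).
    by case: (fop _ b).
  have [t0 [t0m _]] := exists_top C dlam; have cm := eta_max dlam t0m.
  by rewrite (minimal_minimum (h _ e1) cm) (minimal_minimum (h _ e2) cm).
have ey : eop i x = Some y by apply/(fopK oL).
move: (ey) (ey); rewrite -{1}e1 -{1}e2 !(eta_eop dlam).
case E1: (fop _ b1) => [c1|] //= -[c1y]; case E2: (fop _ b2) => [c2|] //= -[c2y].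
have cc := IH _ _ c1y c2y tm; rewrite cc in E1.
by move/(fopK oL): E1; move/(fopK oL): E2 => -> [].
Qed.

Lemma eta_fop i (b : L) : fop i (eta b) = omap (@eta L) (eop (star i) b).
Proof.
case E: (eop (star i) b) => [b'|] /=.
  apply/(fopK oL); rewrite (eta_eop dlam).
  by move/(fopK oL): E => ->.
case F: (fop i (eta b)) => [d|] //.
have [d' dd] := eta_surj dlam d.
move/(fopK oL): F; rewrite -dd (eta_eop dlam).
case F: (fop _ d') => [b''|] //= -[/eta_inj bb]; rewrite bb in F.
by move/(fopK oL): F; rewrite E.
Qed.

(** The numbers eps_i and phi_i count how often e_i and f_i can be applied. *)
Lemma eta_epsi i (b : L) : epsi i (eta b) = phii (star i) b.
Proof.
have [n pn] := phii_nat oL (star i) b; rewrite pn.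
elim: n b pn => [|n IH] b pn.
  by apply/(eop_none oL); rewrite (eta_eop dlam); move/(fop_none oL): pn => ->.
case E: (fop (star i) b) => [b1|]; last first.
  by move/(fop_none oL): E; rewrite pn => /eqP; rewrite pnatr_eq0.
have [_ _ p1] := fop_data oL E.
have e1 : epsi i (eta b1) = n%:R by apply: IH; rewrite p1 pn -natr1 addrK.
have F : eop i (eta b) = Some (eta b1) by rewrite (eta_eop dlam) E.
by have [_ -> _] := fop_data oL (proj2 (fopK oL _ _ _) F); rewrite e1 natr1.
Qed.

Lemma eta_phii i (b : L) : phii i (eta b) = epsi (star i) b.
Proof.
have [n pn] := epsi_nat oL (star i) b; rewrite pn.
elim: n b pn => [|n IH] b pn.
  by apply/(fop_none oL); rewrite eta_fop; move/(eop_none oL): pn => ->.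
case E: (eop (star i) b) => [b1|]; last first.
  by move/(eop_none oL): E; rewrite pn => /eqP; rewrite pnatr_eq0.
have [_ e1 _] := fop_data oL (proj2 (fopK oL _ _ _) E).
have p1 : phii i (eta b1) = n%:R.
  by apply: IH; move: e1; rewrite pn -natr1 => /addIr.
have F : fop i (eta b) = Some (eta b1) by rewrite eta_fop E.
by have [_ _] := fop_data oL F; rewrite p1 -natr1 => ->; rewrite subrK.
Qed.

End OnIrreducibleBijective.

(** Apply eta twice on B_(fund j), where only f_j acts on the maximum and eta
    (eta t) is again the maximum. *)
Lemma starK : involutive (@star R V Phi).
Proof.
move=> j; have dj := fund_dominant j.
have oL := objL C dj; have [t [tm tw]] := exists_top C dj.
have et i : epsi i t = 0 by apply/(eop_none oL)/(maximum_maximal oL).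
have [i ij] := star_surj j.
have ett : eta (eta t) = t.
  apply: (maximal_maximum oL) => // a; rewrite (eta_eop dj).
  by rewrite (minimum_fop oL) //; apply: eta_max.
have: phii j t <> 0.
  rewrite phiiE et addr0 /wti tw fund_pairing eqxx => /eqP.
  by rewrite oner_eq0.
rewrite -{1}ett (eta_phii dj) (eta_epsi dj) phiiE et addr0 /wti tw fund_pairing.
by case: eqP.
Qed.

Lemma etaK lam (dlam : dominant Phi lam) (b : gB C lam) : eta (eta b) = b.
Proof.
have oL := objL C dlam; have [t [tm _]] := exists_top C dlam.
move: b; apply: (maximum_ind tm) => [|i b b' f eb].
  apply: (maximal_maximum oL) => // a; rewrite (eta_eop dlam).
  by rewrite (minimum_fop oL) //; apply: eta_max.
have : fop i (eta (eta b)) = Some (eta (eta b')).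
  by rewrite (eta_fop dlam) (eta_eop dlam) starK f.
by rewrite eb f => -[].
Qed.

End Lusztig.

(** * Irreducible crystals of minuscule highest weight *)

Section MinusculeIrreducible.
Context {R : realFieldType} {V : vectType R} {Phi : root_system V}.
Context (C : gcrystal_category Phi).
Variables (lam : V) (dlam : dominant Phi lam) (mlam : minuscule Phi lam).
Local Notation I := 'I_(rk Phi).
Local Notation alpha := (simple Phi).
Local Notation L := (gB C lam).
Local Notation oL := (objL C dlam).

Lemma minuscule_pairingi u (i : I) : minuscule Phi u ->
  [\/ pairingi u i = 0, pairingi u i = 1 | pairingi u i = -1].
Proof.
case=> _ /(_ _ (simple_root i)); rewrite !inE -/(pairingi u i).
by case/or3P => /eqP ->; [constructor 1 | constructor 2 | constructor 3].
Qed.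

Lemma orbit_minuscule u v : minuscule Phi u -> in_orbit Phi u v -> minuscule Phi v.
Proof. by move=> um [s ->]; apply: wact_minuscule. Qed.

(** An element whose weight mu lies in the orbit of lam has |mu| = |lam|, and no
    weight of B_lam is longer than lam.  This excludes
    |mu + alpha_i| > |mu|, and with it every value of the pairing but -1. *)
Lemma orbit_eop i (b b' : L) : in_orbit Phi lam (wt b) ->
  eop i b = Some b' -> wti i b = -1.
Proof.
move=> ob /(fopK oL)/(fop_data oL)[w _ _].
have := wt_norm dlam b'.
have -> : form Phi lam lam = form Phi (wt b) (wt b).
  by case: ob => s ->; rewrite wact_form.
have -> : wt b' = wt b + alpha i by rewrite w subrK.
have := form_alpha i (wt b); have := form_alpha_gt0 i.
rewrite formDl !formDr (formC _ (alpha i) (wt b)).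
have [h|h|h //] := minuscule_pairingi i (orbit_minuscule mlam ob); rewrite h; lra.
Qed.

Lemma orbit_fop i (b b' : L) : in_orbit Phi lam (wt b) ->
  fop i b = Some b' -> wti i b = 1.
Proof.
move=> ob /(fop_data oL)[w _ _].
have := wt_norm dlam b'.
have -> : form Phi lam lam = form Phi (wt b) (wt b).
  by case: ob => s ->; rewrite wact_form.
rewrite w; have := form_alpha i (wt b); have := form_alpha_gt0 i.
rewrite formDl !formDr !(formC _ _ (- alpha i)) !formNl (formC _ (alpha i) (wt b)).
rewrite !(formC _ _ (- alpha i)) !formNl.
have [h|h //|h] := minuscule_pairingi i (orbit_minuscule mlam ob); rewrite h; lra.
Qed.

Lemma minuscule_wt_orbit (b : L) : in_orbit Phi lam (wt b).
Proof.
have [t [tm tw]] := exists_top C dlam.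
move: b; apply: (maximum_ind tm) => [|i b b' f ob].
  by rewrite tw; apply: in_orbit_self.
have wb := orbit_fop ob f; have [-> _ _] := fop_data oL f.
have -> : wt b - alpha i = refl i (wt b).
  by rewrite /refl -/(wti i b) wb scale1r.
exact: in_orbit_refl.
Qed.

Lemma minuscule_wt (b : L) : minuscule Phi (wt b).
Proof. exact: orbit_minuscule mlam (minuscule_wt_orbit b). Qed.

Lemma minuscule_fop_some i (b : L) :
  (exists b', fop i b = Some b') <-> wti i b = 1.
Proof.
split=> [[b']|w1]; first exact: orbit_fop (minuscule_wt_orbit b).
case E: (fop i b) => [b'|]; first by exists b'.
move/(fop_none oL): E; rewrite phiiE w1 => E.
by have := epsi_ge0 oL i b; lra.
Qed.

Lemma minuscule_eop_some i (b : L) :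
  (exists b', eop i b = Some b') <-> wti i b = -1.
Proof.
split=> [[b']|w1]; first exact: orbit_eop (minuscule_wt_orbit b).
case E: (eop i b) => [b'|]; first by exists b'.
move/(eop_none oL): E => E; have := phii_ge0 oL i b.
by rewrite phiiE w1 E; lra.
Qed.

Lemma minuscule_epsi i (b : L) : epsi i b = Num.max 0 (- wti i b).
Proof.
have nf : wti i b <> 1 -> phii i b = 0.
  move=> w; apply/(fop_none oL); case E: (fop i b) => [b'|] //.
  by case: w; apply/minuscule_fop_some; exists b'.
have ne : wti i b <> -1 -> epsi i b = 0.
  move=> w; apply/(eop_none oL); case E: (eop i b) => [b'|] //.
  by case: w; apply/minuscule_eop_some; exists b'.
case: (minuscule_pairingi i (minuscule_wt b)); rewrite -/(wti i b) => w.
- by rewrite w oppr0 maxxx ne // w => h; lra.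
- by rewrite w ne ?w => [|h]; [rewrite max_l //|]; lra.
have : phii i b = 0 by apply: nf; rewrite w => h; lra.
by rewrite phiiE w opprK max_r // => h; lra.
Qed.

(** The weight decides which e_i act, so two elements of the same weight can be
    raised in parallel until one of them, and then the other, is the maximum. *)
Lemma minuscule_wt_inj (b b' : L) : wt b = wt b' -> b = b'.
Proof.
have [t [tm _]] := exists_top C dlam.
move: b b'; apply: (maximum_ind tm) => [|i b c f IH] b' w.
  apply/esym/(maximal_maximum oL) => // i; apply/(eop_none oL).
  rewrite minuscule_epsi /wti -w -/(wti i t) -minuscule_epsi.
  by apply/(eop_none oL)/(maximum_maximal oL).
have ec : eop i c = Some b by apply/(fopK oL).
have w1 : wti i b' = -1.
  by rewrite /wti -w; apply/minuscule_eop_some; exists b.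
have [d ed] := proj2 (minuscule_eop_some i b') w1.
have fd := proj2 (fopK oL _ _ _) ed.
have bd : b = d.
  apply: IH; have [wc _ _] := fop_data oL f; have [wd _ _] := fop_data oL fd.
  by apply: (addIr (- alpha i)); rewrite -wc -wd.
by move: fd; rewrite -bd f => -[].
Qed.

End MinusculeIrreducible.

(** * The crystal of words *)

Section Words.
Context {R : realFieldType} {V : vectType R} (Phi : root_system V).
Local Notation I := 'I_(rk Phi).
Local Notation alpha := (simple Phi).
Implicit Types (s t : seq V) (i : I).

Definition letter_eps i (x : V) : R := Num.max 0 (- pairingi x i).
Definition letter_fop i (x : V) : option V :=
  if pairingi x i == 1 then Some (x - alpha i) else None.
Definition letter_eop i (x : V) : option V :=
  if pairingi x i == -1 then Some (x + alpha i) else None.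

Fixpoint word_eps i s : R :=
  if s is x :: s' then Num.max (letter_eps i x) (word_eps i s' - pairingi x i)
  else 0.

Fixpoint word_fop i s : option (seq V) :=
  if s is x :: s' then
    if letter_eps i x <= word_eps i s' - pairingi x i
    then omap (cons x) (word_fop i s')
    else omap (cons^~ s') (letter_fop i x)
  else None.

Fixpoint word_eop i s : option (seq V) :=
  if s is x :: s' then
    if word_eps i s' - pairingi x i <= letter_eps i x
    then omap (cons^~ s') (letter_eop i x)
    else omap (cons x) (word_eop i s')
  else None.

Definition word_wt s : V := \sum_(x <- s) x.

(** All tensor products of minuscule crystals at once, as one crystal of
    words: the tensor product becomes concatenation and is strictly
    associative.  On words with minuscule letters it satisfies the axioms of a
    crystal of a representation. *)
Definition words : crystal Phi := {|
  car := seq V;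
  wt := word_wt;
  eps s := \sum_i word_eps i s *: fund Phi i;
  fop := word_fop;
  eop := word_eop |}.

Lemma words_epsi i (s : words) : epsi i s = word_eps i s.
Proof. exact: fund_sum_pairing. Qed.

Lemma word_wt_nil : word_wt [::] = 0.
Proof. exact: big_nil. Qed.
Lemma word_wt_cons x s : word_wt (x :: s) = x + word_wt s.
Proof. exact: big_cons. Qed.
Lemma word_wt_cat s t : word_wt (s ++ t) = word_wt s + word_wt t.
Proof. exact: big_cat. Qed.
Lemma word_wt1 x : word_wt [:: x] = x.
Proof. by rewrite word_wt_cons word_wt_nil addr0. Qed.

Lemma letter_eps_ge0 i x : 0 <= letter_eps i x.
Proof. by rewrite le_max lexx. Qed.

Lemma word_eps_ge0 i s : 0 <= word_eps i s.
Proof. by case: s => //= x s; rewrite le_max letter_eps_ge0. Qed.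

Lemma word_eps_cat i s t :
  word_eps i (s ++ t) =
  Num.max (word_eps i s) (word_eps i t - pairingi (word_wt s) i).
Proof.
elim: s => [|x s IH] /=.
  by rewrite word_wt_nil pairingi0 subr0 max_r // word_eps_ge0.
rewrite IH word_wt_cons pairingiD opprD addrA addr_maxl -[RHS]maxA.
by rewrite [_ - _ - pairingi x i]addrAC.
Qed.

Lemma word_fop_cat i s t :
  word_fop i (s ++ t) =
  if word_eps i s <= word_eps i t - pairingi (word_wt s) i
  then omap (cat s) (word_fop i t) else omap (cat^~ t) (word_fop i s).
Proof.
elim: s => [|x s IH] /=.
  by rewrite word_wt_nil pairingi0 subr0 word_eps_ge0; case: (word_fop i t).
rewrite word_eps_cat word_wt_cons pairingiD opprD addrA IH.
move: (letter_eps i x) => e; rewrite ge_max.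
set a := word_eps i s; set b := word_eps i t.
set c := pairingi x i; set d := pairingi (word_wt s) i.
have [le|lt] := lerP a (b - d).
  have -> : (a - c <= b - c - d) by lra.
  have -> : b - d - c = b - c - d by lra.
  rewrite andbT; case: (lerP e (b - c - d)) => h; first by case: (word_fop i t).
  have -> : (e <= a - c) = false by apply/negbTE; rewrite -ltNge; lra.
  by case: letter_fop.
have -> : (a - c <= b - c - d) = false by apply/negbTE; rewrite -ltNge; lra.
rewrite andbF; case: ifP => _; first by case: (word_fop i s).
by case: letter_fop.
Qed.

Lemma word_eop_eps0 i s : word_eps i s <= 0 -> word_eop i s = None.
Proof.
case: s => //= x s; rewrite ge_max => /andP[ex h].
have ex0 : letter_eps i x = 0 by apply/eqP; rewrite eq_le ex letter_eps_ge0.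
rewrite ex0 h /letter_eop; case: eqP => // x1.
by move: ex; rewrite /letter_eps x1 opprK ge_max ler10 andbF.
Qed.

Lemma word_eop_cat i s t :
  word_eop i (s ++ t) =
  if word_eps i t - pairingi (word_wt s) i <= word_eps i s
  then omap (cat^~ t) (word_eop i s) else omap (cat s) (word_eop i t).
Proof.
elim: s => [|x s IH] /=.
  rewrite word_wt_nil pairingi0 subr0; case: ifP => [/word_eop_eps0 -> //|_].
  by case: (word_eop i t).
rewrite word_eps_cat word_wt_cons pairingiD opprD addrA IH.
move: (letter_eps i x) => e; rewrite le_max.
set a := word_eps i s; set b := word_eps i t.
set c := pairingi x i; set d := pairingi (word_wt s) i.
have [le|lt] := lerP (b - d) a.
  have -> : (b - c - d <= a - c) by lra.
  rewrite orbT; case: ifP => _; last by case: (word_eop i s).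
  by case: letter_eop.
have -> : (b - c - d <= a - c) = false by apply/negbTE; rewrite -ltNge; lra.
have -> : b - d - c = b - c - d by lra.
rewrite orbF; case: (lerP (b - c - d) e) => h; last by case: (word_eop i t).
have -> : a - c <= e by lra.
by case: letter_eop.
Qed.

Lemma word_fop_size i s s' : word_fop i s = Some s' -> size s' = size s.
Proof.
elim: s s' => //= x s IH s'; case: ifP => _.
  by case E: (word_fop i s) => [t|] //= -[<-] /=; rewrite (IH _ E).
by case: letter_fop => //= y [<-].
Qed.

Definition mword s := forall x, x \in s -> minuscule Phi x.

Lemma mword_cons x s : mword (x :: s) <-> minuscule Phi x /\ mword s.
Proof.
split=> [h|[hx hs] y]; last by rewrite inE => /orP[/eqP->|/hs].
by split=> [|y ys]; apply: h; rewrite inE ?eqxx ?ys ?orbT.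
Qed.

Lemma mword_cat s t : mword (s ++ t) <-> mword s /\ mword t.
Proof.
split=> [h|[hs ht] x]; last by rewrite mem_cat => /orP[/hs|/ht].
by split=> x xs; apply: h; rewrite mem_cat xs ?orbT.
Qed.

Lemma letter_fop_minuscule i x y : letter_fop i x = Some y ->
  minuscule Phi x <-> minuscule Phi y.
Proof.
rewrite /letter_fop; case: eqP => // x1 [<-].
have -> : x - alpha i = refl i x by rewrite /refl x1 scale1r.
by split=> [|/(refl_minuscule i)]; [apply: refl_minuscule | rewrite reflK].
Qed.

Lemma word_fop_mword i s s' : word_fop i s = Some s' -> mword s <-> mword s'.
Proof.
elim: s s' => //= x s IH s'; case: ifP => _.
  by case E: (word_fop i s) => [t|] //= -[<-]; rewrite !mword_cons (IH _ E).
case E: letter_fop => [y|] //= -[<-].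
by rewrite !mword_cons (letter_fop_minuscule E).
Qed.

Definition wconn : relation words := @connected _ _ _ words.

Lemma wconn_refl s : wconn s s. Proof. exact: rst_refl. Qed.
Lemma wconn_sym s t : wconn s t -> wconn t s. Proof. exact: rst_sym. Qed.
Lemma wconn_trans s t u : wconn s t -> wconn t u -> wconn s u.
Proof. exact: rst_trans. Qed.
Lemma wconn_fop i s t : word_fop i s = Some t -> wconn s t.
Proof. by move=> f; apply: rst_sym; apply: rst_step; exists i. Qed.

Lemma wconn_equiv_ind (P : words -> words -> Prop) :
  (forall s, P s s) -> (forall s t, P s t -> P t s) ->
  (forall s t u, P s t -> P t u -> P s u) ->
  (forall i s t, word_fop i s = Some t -> P s t) ->
  forall s t, wconn s t -> P s t.
Proof.
move=> Pr Ps Pt Pf s t; elim=> {s t} [s t [i /Pf/Ps]|||] //.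
  by move=> s t _ /Ps.
by move=> s t u _ h1 _ h2; apply: Pt h1 h2.
Qed.

Lemma wconn_mword s t : wconn s t -> mword s <-> mword t.
Proof.
move: s t; apply: wconn_equiv_ind => [//|s t ->//|s t u -> //|i s t].
exact: word_fop_mword.
Qed.

Lemma wconn_size s t : wconn s t -> size s = size t.
Proof.
move: s t; apply: wconn_equiv_ind => [//|s t ->//|s t u -> //|i s t].
by move/word_fop_size.
Qed.

(** An operator acts inside the first n letters or inside the others, so the
    pieces of connected words are connected. *)
Lemma wconn_take n s t : wconn s t -> wconn (take n s) (take n t).
Proof.
move: s t; apply: wconn_equiv_ind => [s|s t|s t u|i s t]; first exact: wconn_refl.
- exact: wconn_sym.
- exact: wconn_trans.
move=> F; have sz := word_fop_size F.
case: (leqP (size s) n) => [h|/ltnW h].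
  by rewrite !take_oversize ?sz //; apply: wconn_fop F.
move: F; rewrite -{1}(cat_take_drop n s) word_fop_cat; case: ifP => _.
  case E: (word_fop i (drop n s)) => [d|] //= [<-].
  by rewrite take_size_cat ?size_takel //; apply: wconn_refl.
case E: (word_fop i (take n s)) => [d|] //= [<-].
rewrite (take_size_cat (n := n)) ?(word_fop_size E) ?size_takel //.
exact: wconn_fop E.
Qed.

Lemma wconn_drop n s t : wconn s t -> wconn (drop n s) (drop n t).
Proof.
move: s t; apply: wconn_equiv_ind => [s|s t|s t u|i s t]; first exact: wconn_refl.
- exact: wconn_sym.
- exact: wconn_trans.
move=> F; have sz := word_fop_size F.
case: (leqP (size s) n) => [h|/ltnW h].
  by rewrite !drop_oversize ?sz //; apply: wconn_refl.
move: F; rewrite -{1}(cat_take_drop n s) word_fop_cat; case: ifP => _.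
  case E: (word_fop i (drop n s)) => [d|] //= [<-].
  by rewrite drop_size_cat ?size_takel //; apply: wconn_fop E.
case E: (word_fop i (take n s)) => [d|] //= [<-].
by rewrite drop_size_cat ?(word_fop_size E) ?size_takel //; apply: wconn_refl.
Qed.

Lemma wconn_split s1 s2 t1 t2 : size s1 = size t1 ->
  wconn (s1 ++ s2) (t1 ++ t2) -> wconn s1 t1 /\ wconn s2 t2.
Proof.
move=> sz h; have := wconn_take (size s1) h; have := wconn_drop (size s1) h.
by rewrite !drop_size_cat // !take_size_cat.
Qed.

End Words.

(** * Inclusions into the words *)

Section Inclusions.
Context {R : realFieldType} {V : vectType R} {Phi : root_system V}.
Local Notation I := 'I_(rk Phi).
Local Notation words := (words Phi).

Lemma inclusion_comp (A B D : crystal Phi) (m : A -> B) (n : B -> D) :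
  crystal_inclusion m -> crystal_inclusion n -> crystal_inclusion (n \o m).
Proof.
move=> [[mw me mf mE] mi] [[nw ne nf nE] ni]; split; last exact: inj_comp.
split=> [a|a|i a|i a] /=; rewrite ?nw ?ne //.
  by rewrite nf mf; case: (fop i a).
by rewrite nE mE; case: (eop i a).
Qed.

Lemma inclusion_eps (A : crystal Phi) (u : A -> words) i a :
  crystal_inclusion u -> word_eps i (u a) = epsi i a.
Proof. by move=> [[_ ue _ _] _]; rewrite -words_epsi /epsi ue. Qed.

Lemma inclusion_wti (A : crystal Phi) (u : A -> words) (i : I) a :
  crystal_inclusion u -> pairingi (word_wt (u a)) i = wti i a.
Proof. by move=> [[uw _ _ _] _]; rewrite /wti -uw. Qed.

(** The words u a have a fixed length, so both pieces can be recovered from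
    their concatenation. *)
Lemma cat_inclusion (A B : crystal Phi) (u : A -> words) (v : B -> words) n :
  crystal_inclusion u -> crystal_inclusion v -> (forall a, size (u a) = n) ->
  crystal_inclusion (fun x : tensor2 A B => (u x.1 ++ v x.2) : words).
Proof.
move=> hu hv sz; have [[uw ue uf uE] ui] := hu; have [[vw ve vf vE] vi] := hv.
split; last first.
  move=> [a b] [a' b'] /= /eqP; rewrite eqseq_cat ?sz // => /andP[/eqP e1 /eqP e2].
  by rewrite (ui _ _ e1) (vi _ _ e2).
split=> [[a b]|[a b]|i [a b]|i [a b]] /=.
- by rewrite word_wt_cat [word_wt (u a)]uw [word_wt (v b)]vw.
- apply: eq_bigr => i _; congr (_ *: _).
  by rewrite word_eps_cat !inclusion_eps // inclusion_wti.
- rewrite word_fop_cat !inclusion_eps // inclusion_wti //.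
  rewrite [word_fop i (v b)]vf [word_fop i (u a)]uf.
  by case: ifP => _; [case: (fop i b) | case: (fop i a)].
rewrite word_eop_cat !inclusion_eps // inclusion_wti //.
rewrite [word_eop i (v b)]vE [word_eop i (u a)]uE.
by case: ifP => _; [case: (eop i a) | case: (eop i b)].
Qed.

End Inclusions.

(** * Lusztig's involution on words *)

Section Embedding.
Context {R : realFieldType} {V : vectType R} {Phi : root_system V}.
Context (C : gcrystal_category Phi).
Local Notation I := 'I_(rk Phi).
Local Notation alpha := (simple Phi).
Local Notation words := (words Phi).
Local Notation mword := (mword Phi).
Local Notation wconn := (@wconn R V Phi).

Lemma iso_inverse (A B : crystal Phi) (m : A -> B) :
  crystal_morphism m -> bijective m -> exists n : B -> A,
  crystal_inclusion n /\ cancel n m.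
Proof.
move=> [mw me mf mE] [n mn nm]; exists n; split=> //; split; last exact: can_inj nm.
split=> [b|b|i b|i b]; rewrite -{2}(nm b) ?mw ?me // ?mf ?mE.
  by case: (fop i (n b)) => //= x; rewrite mn.
by case: (eop i (n b)) => //= x; rewrite mn.
Qed.

Lemma dsum_inclusion n (A : 'I_n -> crystal Phi) j :
  crystal_inclusion (existT _ j : A j -> dsum A).
Proof.
split; first by split.
by move=> a b e; apply: (eq_from_Tagged (T_ := fun j => car (A j)) e).
Qed.

(** Every element lies in an irreducible component. *)
Lemma gobj_cover (B : crystal Phi) (b : B) : gobj C B ->
  exists lam (m : gB C lam -> B) c,
    [/\ dominant Phi lam, crystal_inclusion m & m c = b].
Proof.
move=> /g_objects [n [lam [dl [m [mm mb]]]]].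
have [m' [m'i m'm]] := iso_inverse mm mb.
have m'K : m' (m b) = b by apply: (bij_inj mb); rewrite m'm.
move E: (m b) => x; case: x E => j c E.
exists (lam j), (m' \o existT _ j), c; split=> //=; last by rewrite -E.
exact: inclusion_comp (dsum_inclusion _ _) m'i.
Qed.

Definition embedded (s : words) := exists lam (m : gB C lam -> words) b,
  [/\ dominant Phi lam, crystal_inclusion m & m b = s].

Lemma letter_inclusion lam : dominant Phi lam -> minuscule Phi lam ->
  crystal_inclusion (fun b : gB C lam => [:: wt b] : words).
Proof.
move=> dl ml; have oL := objL C dl; split; last first.
  by move=> b b' [] /(minuscule_wt_inj dl ml).
have e0 i b : 0 - pairingi (wt b) i <= letter_eps i (wt (b : gB C lam)).
  by rewrite sub0r /letter_eps le_max lexx orbT.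
split=> [b|b|i b|i b] /=.
- exact: word_wt1.
- rewrite (fund_expand Phi (eps b)); apply: eq_bigr => i _; congr (_ *: _).
  rewrite -[RHS]/(epsi i b) (minuscule_epsi dl ml) max_l //.
- case E: (fop i b) => [b'|] /=.
    have w1 : wti i b = 1 by apply/(minuscule_fop_some dl ml); exists b'.
    have [-> _ _] := fop_data oL E.
    rewrite /letter_eps /letter_fop -/(wti i b) w1 eqxx /= sub0r max_l ?oppr_le0 //.
    by rewrite oppr_ge0 ler10.
  case: ifP => // _; rewrite /letter_fop; case: eqP => // w1.
  have [b'] := proj2 (minuscule_fop_some dl ml i b) w1.
  by rewrite E.
rewrite e0; case E: (eop i b) => [b'|] /=.
  have w1 : wti i b = -1 by apply/(minuscule_eop_some dl ml); exists b'.
  have [w _ _] := fop_data oL (proj2 (fopK oL _ _ _) E).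
  by rewrite /letter_eop -/(wti i b) w1 eqxx /= w subrK.
rewrite /letter_eop; case: eqP => // w1.
have [b'] := proj2 (minuscule_eop_some dl ml i b) w1.
by rewrite E.
Qed.

Lemma minuscule0 : minuscule Phi 0.
Proof. by split=> [|a _]; [apply: weight0 | rewrite pairing0l !inE eqxx]. Qed.

Lemma dominant0 : dominant Phi 0.
Proof. by split=> [|i]; [apply: weight0 | rewrite pairingi0]. Qed.

Lemma nil_inclusion : crystal_inclusion (fun b : gB C 0 => [::] : words).
Proof.
have w0 (b : gB C 0) : wt b = 0.
  have [s ->] := minuscule_wt_orbit dominant0 minuscule0 b.
  by elim: s => //= i s ->; rewrite /refl pairingi0 scale0r subr0.
split; last first.
  by move=> b b' _; apply: (minuscule_wt_inj dominant0 minuscule0); rewrite !w0.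
split=> [b|b|i b|i b] /=.
- by rewrite w0 word_wt_nil.
- rewrite (fund_expand Phi (eps b)); apply: eq_bigr => i _; congr (_ *: _).
  rewrite -[RHS]/(epsi i b) (minuscule_epsi dominant0 minuscule0).
  by rewrite /wti w0 pairingi0 oppr0 maxxx.
- case E: (fop i b) => [b'|] //.
  have /eqP : wti i b = 1.
    by apply/(minuscule_fop_some dominant0 minuscule0); exists b'.
  by rewrite /wti w0 pairingi0 eq_sym oner_eq0.
case E: (eop i b) => [b'|] //.
have /eqP : wti i b = -1.
  by apply/(minuscule_eop_some dominant0 minuscule0); exists b'.
by rewrite /wti w0 pairingi0 eq_sym oppr_eq0 oner_eq0.
Qed.

(** Add one letter at a time in front: a letter is an element of a minuscule
    irreducible crystal, and a tensor product of irreducible crystals is a sum of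
    irreducible ones by the axioms.  Through this lemma the axioms of
    the category become available for words. *)
Lemma mword_embedded (s : words) : mword s -> embedded s.
Proof.
elim: s => [_|x s IH /mword_cons[xm /IH[lam [m [b [dl mi <-]]]]]].
  have [t _] := exists_top C dominant0.
  exists 0, (fun=> [::]), t; split=> //; [exact: dominant0 | exact: nil_inclusion].
have [om [xo dom]] := weight_orbit_dominant (proj1 xm).
have omm : minuscule Phi om by apply: orbit_minuscule xo.
have [t [_ tw]] := exists_top C dom.
have [c cx] : exists c : gB C om, wt c = x.
  by apply: (wt_orbit (objL C dom) (b := t)); rewrite tw; apply: in_orbit_sym.
have [nu [n [d [dn ni nd]]]] :=
  gobj_cover ((c, b) : tensor2 _ _) (g_tensor (objL C dom) (objL C dl)).
have ci := cat_inclusion (letter_inclusion dom omm) mi (fun=> erefl).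
by exists nu, (fun e => wt (n e).1 :: m (n e).2), d; split=> //;
  [exact: inclusion_comp ni ci | rewrite nd cx].
Qed.

Section Image.
Variables (A : crystal Phi) (m : A -> words) (mi : crystal_inclusion m).

Lemma image_fop i (a : A) : word_fop i (m a) = omap m (fop i a).
Proof. by case: mi => -[_ _ h _] _; apply: h. Qed.

Lemma image_eop i (a : A) : word_eop i (m a) = omap m (eop i a).
Proof. by case: mi => -[_ _ _ h] _; apply: h. Qed.

End Image.

(** The image of an inclusion is a whole component.  Its maximum is
    determined by any of its words, and it determines the highest weight and the
    inclusion. *)
Lemma inclusion_unique lam mu (m : gB C lam -> words) (n : gB C mu -> words) b c
    (eta : forall B : crystal Phi, B -> B) :
  dominant Phi lam -> dominant Phi mu ->
  crystal_inclusion m -> crystal_inclusion n -> m b = n c ->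
  m (eta _ b) = n (eta _ c).
Proof.
move=> dl dm mi ni mbnc; have [t [tm tw]] := exists_top C dl.
have [t' [tm' tw']] := exists_top C dm.
have [x mx] : exists x, m t = n x.
  have h := clos_rt_rt1n _ _ _ _ (tm b).
  elim: h c mbnc => {b t tm tw} [b c bc|b y z [i fy] _ IH c bc]; first by exists c.
  have : word_eop i (n c) = Some (m y).
    by rewrite -bc (image_eop mi); move/(fopK (objL C dl)): fy => ->.
  rewrite (image_eop ni); case: (eop i c) => //= c' [/esym]; exact: IH.
have xt : x = t'.
  apply: (maximal_maximum (objL C dm)) => // i.
  have : word_eop i (n x) = None.
    by rewrite -mx (image_eop mi) (maximum_maximal (objL C dl) tm).
  by rewrite (image_eop ni); case: (eop i x).
have lm : lam = mu.
  case: mi => -[mw _ _ _] _; case: ni => -[nw _ _ _] _.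
  by rewrite -tw -mw mx xt nw tw'.
subst mu; have mn : m =1 n.
  apply: (maximum_ind tm).
    have oL := objL C dl; rewrite mx; congr n.
    by rewrite xt (maximal_maximum oL (maximum_maximal oL tm) tm').
  move=> i y y' f my; have := image_fop mi i y; rewrite my (image_fop ni) f /=.
  by case.
by move: mbnc; rewrite mn => e; rewrite (proj2 ni _ _ e) mn.
Qed.

Context (eta : forall B : crystal Phi, B -> B) (Heta : lusztig_involution C eta).

(** Lusztig's involution of a word, computed in the irreducible crystal that
    contains it, which is unique by [inclusion_unique].  The empty word is a
    default for the words that no such crystal contains. *)
Definition etaw (s : seq V) : seq V :=
  xget [::] [set t | exists lam (m : gB C lam -> words) b,
    [/\ dominant Phi lam, crystal_inclusion m, m b = s & t = m (eta b)]]%classic.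

Lemma etaw_irreducible lam (m : gB C lam -> words) b :
  dominant Phi lam -> crystal_inclusion m -> etaw (m b) = m (eta b).
Proof.
move=> dl mi; rewrite /etaw; case: xgetP => [t _ [mu [n [c [dm ni nc ->]]]]|].
  exact: (inclusion_unique eta dm dl ni mi nc).
by move/(_ (m (eta b)))=> []; exists lam, m, b.
Qed.

(** So computations of eta in any crystal that embeds in the words can be
    made with words. *)
Lemma etaw_inclusion (B : crystal Phi) (u : B -> words) b :
  gobj C B -> crystal_inclusion u -> etaw (u b) = u (eta b).
Proof.
move=> oB ui; have [lam [m [c [dl mi <-]]]] := gobj_cover b oB.
have [_ h] := Heta; rewrite (h _ oB _ dl _ mi).
exact: (etaw_irreducible c dl (inclusion_comp mi ui)).
Qed.

Definition word_phi (i : I) (s : seq V) : R := pairingi (word_wt s) i + word_eps i s.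
Definition highest (s : seq V) := forall i : I, word_eop i s = None.
Definition lowest (s : seq V) := forall i : I, word_fop i s = None.

Lemma inclusion_phi (A : crystal Phi) (u : A -> words) i a :
  crystal_inclusion u -> word_phi i (u a) = phii i a.
Proof. by move=> ui; rewrite /word_phi inclusion_wti // inclusion_eps // phiiE. Qed.

Section OneWord.
Variables (s : seq V) (ms : mword s).
Implicit Type i : I.

Lemma word_phi_nat i : exists n : nat, word_phi i s = n%:R.
Proof.
have [lam [m [b [dl mi <-]]]] := mword_embedded ms.
by rewrite inclusion_phi //; apply: (phii_nat (objL C dl)).
Qed.

Lemma word_eop_none i : word_eop i s = None <-> word_eps i s = 0.
Proof.
have [lam [m [b [dl mi <-]]]] := mword_embedded ms.
rewrite inclusion_eps // -(eop_none (objL C dl)) (image_eop mi).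
by case: (eop i b).
Qed.

Lemma word_eopK i s' : word_eop i s = Some s' -> word_fop i s' = Some s.
Proof.
have [lam [m [b [dl mi <-]]]] := mword_embedded ms; rewrite (image_eop mi).
case E: (eop i b) => [b'|] //= -[<-]; rewrite (image_fop mi).
by move/(fopK (objL C dl)): E => ->.
Qed.

Lemma word_fopK i s' : word_fop i s = Some s' -> word_eop i s' = Some s.
Proof.
have [lam [m [b [dl mi <-]]]] := mword_embedded ms; rewrite (image_fop mi).
case E: (fop i b) => [b'|] //= -[<-]; rewrite (image_eop mi).
by move/(fopK (objL C dl)): E => ->.
Qed.

Lemma word_fop_wt i s' : word_fop i s = Some s' ->
  word_wt s' = word_wt s - alpha i.
Proof.
have [lam [m [b [dl mi <-]]]] := mword_embedded ms; rewrite (image_fop mi).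
case E: (fop i b) => [b'|] //= -[<-]; have [wb _ _] := fop_data (objL C dl) E.
case: (mi) => -[mw _ _ _] _.
by rewrite -[word_wt (m b)]/(wt (m b)) -[word_wt (m b')]/(wt (m b')) !mw wb.
Qed.

Lemma etaw_eop i : word_eop i (etaw s) = omap etaw (word_fop (star i) s).
Proof.
have [lam [m [b [dl mi <-]]]] := mword_embedded ms.
rewrite etaw_irreducible // (image_eop mi) (image_fop mi) (eta_eop Heta dl).
by case: (fop _ b) => //= b'; rewrite etaw_irreducible.
Qed.

Lemma etaw_fop i : word_fop i (etaw s) = omap etaw (word_eop (star i) s).
Proof.
have [lam [m [b [dl mi <-]]]] := mword_embedded ms.
rewrite etaw_irreducible // (image_eop mi) (image_fop mi) (eta_fop Heta dl).
by case: (eop _ b) => //= b'; rewrite etaw_irreducible.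
Qed.

Lemma etawK : etaw (etaw s) = s.
Proof.
have [lam [m [b [dl mi <-]]]] := mword_embedded ms.
by rewrite !etaw_irreducible // (etaK Heta dl).
Qed.

Lemma etaw_eps i : word_eps i (etaw s) = word_phi (star i) s.
Proof.
have [lam [m [b [dl mi <-]]]] := mword_embedded ms.
by rewrite etaw_irreducible // inclusion_phi // inclusion_eps // (eta_epsi Heta dl).
Qed.

Lemma etaw_phi i : word_phi i (etaw s) = word_eps (star i) s.
Proof.
have [lam [m [b [dl mi <-]]]] := mword_embedded ms.
by rewrite etaw_irreducible // inclusion_phi // inclusion_eps // (eta_phii Heta dl).
Qed.

Lemma image_wconn (A : crystal Phi) (m : A -> words) a a' :
  crystal_inclusion m -> crystal_le a a' -> wconn (m a) (m a').
Proof.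
move=> mi; elim=> {a a'} [a a' [i f]|a|a b c _ h _ h'].
- by apply: wconn_sym; apply: (wconn_fop (i := i)); rewrite (image_fop mi) f.
- exact: wconn_refl.
- exact: wconn_trans h h'.
Qed.

Lemma wconn_etaw : wconn s (etaw s).
Proof.
have [lam [m [b [dl mi <-]]]] := mword_embedded ms.
have [t [tm _]] := exists_top C dl; rewrite etaw_irreducible //.
by apply: (wconn_trans (image_wconn mi (tm b))); apply/wconn_sym/image_wconn.
Qed.

End OneWord.

Lemma wconn_image s t (A : crystal Phi) (m : A -> words) :
  wconn s t -> mword s -> crystal_inclusion m ->
  (exists b, m b = s) -> exists c, m c = t.
Proof.
move=> st ms mi.
suff [_ h] : (mword s <-> mword t) /\
    (mword s -> (exists b, m b = s) <-> (exists b, m b = t)) by case: (h ms).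
move: s t st {ms}.
apply: wconn_equiv_ind => [//|s t [h1 h2]|s t u [h1 h2] [h3 h4]|i s t f].
- by split=> [|mt]; [case: h1; split | rewrite h2 //; apply/h1].
- by split=> [|ms]; [rewrite h1 | rewrite (h2 ms) h4 //; apply/h1].
split=> [|ms]; first exact: word_fop_mword f.
split=> -[b mb].
  move: f; rewrite -mb (image_fop mi); case: (fop i b) => //= c [<-].
  by exists c.
move: (word_fopK ms f); rewrite -mb (image_eop mi).
by case: (eop i b) => //= c [<-]; exists c.
Qed.

Lemma highest_unique s t :
  mword s -> highest s -> highest t -> wconn s t -> s = t.
Proof.
move=> ms hs ht st; have [lam [m [b [dl mi mb]]]] := mword_embedded ms.
have [c mc] := wconn_image st ms mi (ex_intro _ b mb).
have [x [xm _]] := exists_top C dl; have oL := objL C dl.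
have top d : highest (m d) -> d = x.
  move=> hd; apply: (maximal_maximum oL) => // i; move: (hd i).
  by rewrite (image_eop mi); case: (eop i d).
by rewrite -mb -mc (top b) ?mb // (top c) ?mc.
Qed.

Lemma etaw_mword s : mword s -> mword (etaw s).
Proof. by move=> ms; apply/(wconn_mword (wconn_etaw ms)). Qed.

Lemma etaw_size s : mword s -> size (etaw s) = size s.
Proof. by move=> ms; apply/esym/wconn_size/wconn_etaw. Qed.

Lemma etaw_highest s : mword s -> highest s -> lowest (etaw s).
Proof. by move=> ms hs i; rewrite etaw_fop // hs. Qed.

Lemma etaw_lowest s : mword s -> lowest s -> highest (etaw s).
Proof. by move=> ms hs i; rewrite etaw_eop // hs. Qed.

Lemma lowest_unique s t :
  mword s -> lowest s -> lowest t -> wconn s t -> s = t.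
Proof.
move=> ms hs ht st; have mt : mword t by apply/(wconn_mword st).
rewrite -(etawK ms) -(etawK mt); congr etaw.
apply: highest_unique; [exact: etaw_mword|exact: etaw_lowest|exact: etaw_lowest|].
apply: wconn_trans (wconn_etaw mt); apply: wconn_trans st.
exact/wconn_sym/wconn_etaw.
Qed.

(** By [etaw_eps] and [etaw_phi], since the weight is phi - eps. *)
Lemma etaw_wt s (i : I) : mword s ->
  pairingi (word_wt (etaw s)) i = - pairingi (word_wt s) (star i).
Proof.
move=> ms; have := etaw_eps ms i; have := etaw_phi ms i; rewrite /word_phi.
by move=> h1 h2; lra.
Qed.

(** The words s ++ t and eta t ++ eta s are interchanged by an
    anti-automorphism of the crystal of words, for every way of cutting words
    in two.  The commutor is this map followed by eta on the whole word. *)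
Definition flip (n : nat) (w : seq V) : seq V := etaw (drop n w) ++ etaw (take n w).

Lemma flip_cat s t : flip (size s) (s ++ t) = etaw t ++ etaw s.
Proof. by rewrite /flip take_size_cat // drop_size_cat. Qed.

(** By [etaw_eps] and [etaw_wt], the comparison in the tensor product rule for
    e_i on eta t ++ eta s is the one for f_(star i) on s ++ t. *)
Lemma flip_eop s t (i : I) : mword s -> mword t ->
  word_eop i (etaw t ++ etaw s) = omap (flip (size s)) (word_fop (star i) (s ++ t)).
Proof.
move=> ms mt; rewrite word_eop_cat word_fop_cat !etaw_eps // etaw_wt // /word_phi.
rewrite !etaw_eop //; set j := star i.
have -> : (pairingi (word_wt s) j + word_eps j s - - pairingi (word_wt t) j <=
    pairingi (word_wt t) j + word_eps j t) =
    (word_eps j s <= word_eps j t - pairingi (word_wt s) j).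
  by rewrite opprK addrC lerD2l lerBrDl.
case: ifP => _.
  by case: (word_fop j t) => //= t'; rewrite flip_cat.
by case E: (word_fop j s) => [s'|] //=; rewrite -(word_fop_size E) flip_cat.
Qed.

Lemma flip_fop s t (i : I) : mword s -> mword t ->
  word_fop i (etaw t ++ etaw s) = omap (flip (size s)) (word_eop (star i) (s ++ t)).
Proof.
move=> ms mt; rewrite word_eop_cat word_fop_cat !etaw_eps // etaw_wt // /word_phi.
rewrite !etaw_fop //; set j := star i.
have -> : (pairingi (word_wt t) j + word_eps j t <=
    pairingi (word_wt s) j + word_eps j s - - pairingi (word_wt t) j) =
    (word_eps j t - pairingi (word_wt s) j <= word_eps j s).
  by rewrite opprK [X in _ <= X]addrC lerD2l lerBlDl.
case: ifP => _; last by case: (word_eop j t) => //= t'; rewrite flip_cat.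
case E: (word_eop j s) => [s'|] //=.
by rewrite (word_fop_size (word_eopK ms E)) flip_cat.
Qed.

Lemma flip_mword n w : mword w -> mword (flip n w).
Proof.
rewrite -{1}(cat_take_drop n w) => /mword_cat[mt md].
by apply/mword_cat; split; apply: etaw_mword.
Qed.

Lemma flip_wconn n w w' : (n <= size w)%N -> mword w -> wconn w w' ->
  wconn (flip n w) (flip n w').
Proof.
move=> nw mw h.
suff [_ [_ H]] : (mword w <-> mword w') /\ size w = size w' /\
    (mword w -> (n <= size w)%N -> wconn (flip n w) (flip n w')) by apply: H.
move: w w' h {nw mw}; apply: wconn_equiv_ind =>
  [w|s t [h1 [h2 h3]]|s t u [h1 [h2 h3]] [h4 [h5 h6]]|i s t f].
- by do 2!split=> //; move=> *; apply: wconn_refl.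
- by rewrite h1 h2; do 2!split=> //; rewrite -h1 -h2 => *; apply/wconn_sym/h3.
- rewrite h1 h2; do 2!split=> //; rewrite -h1 -h2 => ms sz.
  by apply: wconn_trans (h3 _ _) (h6 _ _) => //; rewrite -?h1 -?h2.
split; first exact: word_fop_mword f.
split=> [|ms sz]; first by rewrite (word_fop_size f).
have: word_eop (star i) (flip n s) = Some (flip n t).
  have : mword (take n s ++ drop n s) by rewrite cat_take_drop.
  case/mword_cat => mt md; rewrite /flip flip_eop // cat_take_drop.
  by rewrite (starK Heta) f /= size_takel.
by move/(word_eopK (flip_mword ms)) => /wconn_fop/wconn_sym.
Qed.

Lemma flip_lowest s t : mword s -> mword t -> highest (s ++ t) ->
  lowest (etaw t ++ etaw s).
Proof. by move=> ms mt h i; rewrite flip_fop // h. Qed.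

End Embedding.

(** * The commutor on words *)

Section WordCommutor.
Context {R : realFieldType} {V : vectType R} {Phi : root_system V}.
Context (C : gcrystal_category Phi).
Context (eta : forall B : crystal Phi, B -> B) (Heta : lusztig_involution C eta).
Local Notation I := 'I_(rk Phi).
Local Notation alpha := (simple Phi).
Local Notation mword := (mword Phi).
Local Notation wconn := (@wconn R V Phi).
Local Notation highest := (@highest R V Phi).
Local Notation lowest := (@lowest R V Phi).
Local Notation etaw := (etaw C eta).
Local Notation flip := (flip C eta).
Implicit Types s t x p q u : seq V.

Definition wcommutor s t := etaw (etaw t ++ etaw s).

Lemma mword_flip_cat s t : mword s -> mword t -> mword (etaw t ++ etaw s).
Proof. by move=> ms mt; apply/mword_cat; split; apply: etaw_mword. Qed.

Lemma wcommutor_wconn s t : mword s -> mword t ->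
  wconn (etaw t ++ etaw s) (wcommutor s t).
Proof. by move=> ms mt; apply: wconn_etaw => //; apply: mword_flip_cat. Qed.

Lemma wcommutor_mword s t : mword s -> mword t -> mword (wcommutor s t).
Proof. by move=> ms mt; apply: etaw_mword => //; apply: mword_flip_cat. Qed.

Lemma wcommutor_size s t : mword s -> mword t ->
  size (wcommutor s t) = (size s + size t)%N.
Proof.
move=> ms mt; rewrite -(wconn_size (wcommutor_wconn ms mt)) size_cat.
by rewrite !etaw_size // addnC.
Qed.

Lemma wcommutor_highest s t : mword s -> mword t -> highest (s ++ t) ->
  highest (wcommutor s t).
Proof.
move=> ms mt h; apply: (etaw_lowest Heta); first exact: mword_flip_cat.
exact: flip_lowest.
Qed.

Lemma wcommutor_wt s t : mword s -> mword t ->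
  word_wt (wcommutor s t) = word_wt (s ++ t).
Proof.
move=> ms mt; apply: (pairingi_inj (Phi := Phi)) => i.
rewrite (etaw_wt Heta); last exact: mword_flip_cat.
rewrite !word_wt_cat !pairingiD !(etaw_wt Heta) // (starK Heta).
by rewrite opprD !opprK addrC.
Qed.

(** Both sides are the minimum of the component of s ++ t.  It follows that
    the commutor is an involution on highest words. *)
Lemma flip_wcommutor s t : mword s -> mword t -> highest (s ++ t) ->
  flip (size t) (wcommutor s t) = etaw (s ++ t).
Proof.
move=> ms mt h; have mst : mword (s ++ t) by apply/mword_cat.
have mz := wcommutor_mword ms mt; have my := mword_flip_cat ms mt.
apply: (lowest_unique Heta); first exact: flip_mword.
- move: mz (wcommutor_highest ms mt h).
  rewrite -(cat_take_drop (size t) (wcommutor s t)).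
  move=> /mword_cat[m1 m2] hz i; rewrite /flip cat_take_drop.
  exact: flip_lowest.
- exact: etaw_highest.
apply: (wconn_trans (t := s ++ t)); last exact: wconn_etaw.
have -> : s ++ t = flip (size t) (etaw t ++ etaw s).
  by rewrite -(etaw_size C eta mt) flip_cat !etawK.
apply/wconn_sym/flip_wconn => //; last exact: wcommutor_wconn.
by rewrite size_cat etaw_size // leq_addr.
Qed.

Lemma wcommutorK s t (z := wcommutor s t) : mword s -> mword t -> highest (s ++ t) ->
  wcommutor (take (size t) z) (drop (size t) z) = s ++ t.
Proof.
move=> ms mt h; rewrite /wcommutor -/(flip _ z) flip_wcommutor // etawK //.
exact/mword_cat.
Qed.

Lemma highest_eps s (i : I) : mword s -> highest s -> word_eps i s = 0.
Proof. by move=> ms hs; apply/(word_eop_none C ms). Qed.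

Lemma eps_highest s : mword s -> (forall i : I, word_eps i s <= 0) -> highest s.
Proof.
move=> ms hs i; apply/(word_eop_none C ms).
by apply: le_anti; rewrite hs /= word_eps_ge0.
Qed.

Lemma highest_prefix s t : mword (s ++ t) -> highest (s ++ t) -> highest s.
Proof.
move=> m h; have [ms mt] := proj1 (mword_cat _ _ _) m.
apply: eps_highest => // i; have := highest_eps i m h.
by rewrite word_eps_cat => <-; rewrite le_max lexx.
Qed.

Lemma mword_weight s : mword s -> is_weight Phi (word_wt s).
Proof.
elim: s => [_|x s IH /mword_cons[[xw _] /IH sw]].
  by rewrite word_wt_nil; apply: weight0.
by rewrite word_wt_cons; apply: weightD.
Qed.

Lemma highest_dominant s : mword s -> highest s -> dominant Phi (word_wt s).
Proof.
move=> ms hs; split=> [|i]; first exact: mword_weight.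
have [n] := word_phi_nat C ms i; rewrite /word_phi highest_eps // addr0 => ->.
exact: ler0n.
Qed.

(** Given that the first part is highest, the tensor product rule only depends
    on its weight. *)
Lemma highest_change_prefix s t u : mword (s ++ t) -> mword u ->
  highest (s ++ t) -> highest u -> word_wt u = word_wt s -> highest (u ++ t).
Proof.
move=> m mu h hu w; have [ms mt] := proj1 (mword_cat _ _ _) m.
apply: eps_highest => [|i]; first exact/mword_cat.
rewrite word_eps_cat (highest_eps i mu hu) w ge_max lexx /=.
by rewrite -(highest_eps i m h) word_eps_cat le_max lexx orbT.
Qed.

(** Raising a word decreases the height of the difference between the highest
    weight of its component and its own weight. *)
Lemma mword_eop_ind (P : seq V -> Prop) :
  (forall s, mword s -> (forall (i : I) s', word_eop i s = Some s' -> P s') -> P s) ->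
  forall s, mword s -> P s.
Proof.
move=> HP s ms; have [lam [m [b [dl mi mb]]]] := mword_embedded C ms.
have [n hn] := qpos_ht (wt_le_top dl b).
elim: n {-2}n (leqnn n) s ms b mb hn => [|N IH] n nN s ms b mb hn;
  apply: HP => // i s' e.
  move: nN hn; rewrite leqn0 => /eqP ->; move: e; rewrite -mb (image_eop mi).
  case E: (eop i b) => [b'|] // _.
  have [wb _ _] := fop_data (objL C dl) (proj2 (fopK (objL C dl) _ _ _) E).
  have [k] := qpos_ht (wt_le_top dl b'); rewrite wb !(htD, htN) ht_simple => hk h0.
  have : k%:R + 1 = 0 :> R by rewrite -hk; lra.
  by move/eqP; rewrite natr1 pnatr_eq0.
have fs := word_eopK C ms e; have ms' : mword s' by apply/(word_fop_mword fs).
move: e; rewrite -mb (image_eop mi); case E: (eop i b) => [b'|] //= -[mb'].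
have [wb _ _] := fop_data (objL C dl) (proj2 (fopK (objL C dl) _ _ _) E).
have [k hk] := qpos_ht (wt_le_top dl b').
apply: (IH k _ s' ms' b') => //.
suff : n = k.+1 by move=> e; rewrite e in nN.
apply/eqP; rewrite -(eqr_nat R) -natr1 -hk -hn wb !(htD, htN) ht_simple.
by apply/eqP; lra.
Qed.

(** * Growth diagrams *)

(** The column to the left of the column s in a growth diagram whose new column
    starts at the weight lam: the rule that defines [jdt], with the vertical
    edges as letters. *)
Fixpoint slide (lam : V) s : seq V :=
  if s is v :: s' then
    let lam' := domW Phi (lam + v) in (lam' - lam) :: slide lam' s'
  else [::].

Lemma slide_cat lam s t :
  slide lam (s ++ t) = slide lam s ++ slide (lam + word_wt (slide lam s)) t.
Proof.
elim: s lam => [|v s IH] lam /=; first by rewrite word_wt_nil addr0.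
by rewrite IH word_wt_cons addrA subrKC.
Qed.

Lemma slide_size lam s : size (slide lam s) = size s.
Proof. by elim: s lam => //= v s IH lam; rewrite IH. Qed.

Lemma slide_partial lam s i : (i < size s)%N ->
  lam + word_wt (take i.+1 (slide lam s)) =
  domW Phi (lam + word_wt (take i (slide lam s)) + s`_i).
Proof.
elim: s lam i => // v s IH lam [|i] /= h.
  by rewrite take0 word_wt_cons word_wt_nil !addr0 subrKC.
rewrite !word_wt_cons addrA subrKC [lam + (_ + _)]addrA subrKC.
exact: IH.
Qed.

(** A chain of raisings of s, with a minuscule weight mu that is lowered at the
    same time, so that mu + wt s does not change.  Between
    two columns of a growth diagram, the horizontal edges are values of mu. *)
Inductive raises : seq V -> V -> seq V -> V -> Prop :=
| raises_refl s mu : raises s mu s mu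
| raises_step (i : I) s s' mu t nu : word_eop i s = Some s' ->
    word_eps i s = 1 -> pairingi mu i = 1 ->
    raises s' (refl i mu) t nu -> raises s mu t nu.

Lemma raises_trans s mu t nu u ka :
  raises s mu t nu -> raises t nu u ka -> raises s mu u ka.
Proof.
move=> h; elim: h u ka => // i s1 s2 mu1 t1 nu1 e1 e2 e3 _ IH u ka /IH.
exact: raises_step e1 e2 e3.
Qed.

Lemma raises_invariants s mu t nu : raises s mu t nu -> mword s -> minuscule Phi mu ->
  [/\ wconn s t, minuscule Phi nu & mu + word_wt s = nu + word_wt t].
Proof.
elim=> {s mu t nu} [s mu ms mm|i s s' mu t nu e _ m1 _ IH ms mm].
  by split=> //; apply: wconn_refl.
have fs := word_eopK C ms e; have ms' : mword s' by apply/(word_fop_mword fs).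
have [h1 h2 h3] := IH ms' (refl_minuscule i mm); split=> //.
  by apply: wconn_trans h1; apply: wconn_sym; apply: wconn_fop fs.
by rewrite -h3 (word_fop_wt C ms' fs) /refl m1 scale1r addrA addrAC.
Qed.

(** An operator e_i of the chain still acts on s when a letter v is appended.
    The tensor product rule asks for eps_i v - (wt s)_i <= eps_i s = 1; as
    mu_i = 1, this amounts to eps_i v <= (mu + wt s)_i, which follows from the
    dominance of mu + wt s and of mu + wt s + v. *)
Lemma raises_rcons s mu t nu v : raises s mu t nu -> mword s ->
  minuscule Phi mu -> minuscule Phi v ->
  (forall i : I, 0 <= pairingi (mu + word_wt s) i) ->
  (forall i : I, 0 <= pairingi (mu + word_wt s + v) i) ->
  raises (rcons s v) mu (rcons t v) nu.
Proof.
move=> h; elim: h => {s mu t nu} [s mu *|i s s' mu t nu e e1 m1 h IH ms mm vm h1 h2].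
  exact: raises_refl.
have step : raises s mu s' (refl i mu).
  exact: raises_step e e1 m1 (raises_refl _ _).
have [cn mm' w] := raises_invariants step ms mm.
have le : word_eps i [:: v] - pairingi (word_wt s) i <= 1.
  have := h1 i; have := h2 i; rewrite /= !pairingiD m1 /letter_eps.
  by case: (minuscule_pairingi i vm) => ->; rewrite ?opprK ?oppr0 => ? ?;
     rewrite lerBlDr !ge_max; apply/andP; split; try (apply/andP; split); lra.
apply: (@raises_step i _ (rcons s' v)) => //.
- by rewrite -!cats1 word_eop_cat e1 le e.
- by rewrite -cats1 word_eps_cat e1 max_l.
by apply: IH => //; rewrite -?w //; apply/(wconn_mword cn).
Qed.

(** When the word r before it cannot be raised, the last letter v is raised
    within the stabiliser of wt r, until wt r + v is dominant.  The
    dominance of mu + wt r + v forces mu_i = 1 at each step. *)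
Lemma raises_last r v mu : mword r -> highest r -> minuscule Phi mu ->
  minuscule Phi v -> (forall i : I, 0 <= pairingi (mu + word_wt r + v) i) ->
  exists nu, raises (rcons r v) mu
      (rcons r (domW Phi (word_wt r + v) - word_wt r)) nu /\
    highest (rcons r (domW Phi (word_wt r + v) - word_wt r)).
Proof.
move=> mr hr; have dl := highest_dominant mr hr; set lam := word_wt r.
move E: (rcons r v) => s mm vm.
have ms : mword s by rewrite -E -cats1; apply/mword_cat; split=> //; apply/mword_cons.
move: s ms v mu E mm vm; apply: mword_eop_ind => s ms IH v mu E mm vm h.
have lv : is_weight Phi (lam + v) by apply: weightD; [case: dl | case: vm].
have [d0|] := pselect (forall i : I, 0 <= pairingi (lam + v) i).
  rewrite (domW_eq C (v := lam + v) (conj lv d0) (in_orbit_self _ _)).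
  have -> : lam + v - lam = v by rewrite addrAC subrr add0r.
  exists mu; rewrite E; split; first exact: raises_refl.
  apply: eps_highest => // i; rewrite -E -cats1 word_eps_cat highest_eps //.
  rewrite ge_max lexx /= subr_le0 sub0r /letter_eps !ge_max.
  have := d0 i; have := proj2 dl i; rewrite pairingiD -/lam => h1 h2.
  by rewrite h1 /= andbb; lra.
move/existsNP => [i /negP]; rewrite -ltNge => lt0.
have [n ln] := dominant_nat i dl; rewrite -/lam in ln.
have v1 : pairingi v i = -1.
  have := ler0n R n; move: lt0; rewrite pairingiD ln.
  by case: (minuscule_pairingi i vm) => -> // *; lra.
have l0 : pairingi lam i = 0.
  have := ler0n R n.-1; move: lt0; rewrite pairingiD {}ln v1.
  by case: n => // n; rewrite -natr1 => *; lra.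
have m1 : pairingi mu i = 1.
  have := h i; rewrite !pairingiD l0 v1.
  by case: (minuscule_pairingi i mm) => -> // *; lra.
have rv : refl i v = v + alpha i by rewrite /refl v1 scaleN1r opprK.
have le1 : word_eps i [:: v] = 1.
  by rewrite /= /letter_eps v1 opprK add0r [Num.max 0 1]max_r ?ler01 // maxxx.
have e : word_eop i s = Some (rcons r (refl i v)).
  rewrite -E -!cats1 word_eop_cat (highest_eps i mr hr) le1 l0 subr0 ler10 /=.
  rewrite sub0r v1 opprK /letter_eps v1 opprK max_r ?ler01 // lexx.
  by rewrite /letter_eop v1 eqxx /= rv.
have e1 : word_eps i s = 1.
  by rewrite -E -cats1 word_eps_cat highest_eps // le1 l0 subr0 max_r ?ler01.
have [|nu [c hc]] := IH _ _ e _ (refl i mu) erefl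
  (refl_minuscule i mm) (refl_minuscule i vm).
  move=> j; suff -> : refl i mu + lam + refl i v = mu + lam + v by apply: h.
  by rewrite rv /refl m1 scale1r [mu - _ + _]addrAC addrACA addNr addr0.
have dv : domW Phi (lam + refl i v) = domW Phi (lam + v).
  have -> : lam + refl i v = refl i (lam + v).
    by rewrite /refl pairingiD l0 add0r addrA.
  apply/esym/(domW_eq C); first by apply/(domW_dominant C)/refl_weight.
  apply: in_orbit_trans (in_orbit_refl i (in_orbit_self _ _)) _.
  exact/in_orbit_sym/domW_in_orbit.
exists nu; rewrite -dv; split=> //.
exact: (raises_step e e1 m1 c).
Qed.

Lemma slide_rcons lam s v : slide lam (rcons s v) =
  rcons (slide lam s) (domW Phi (lam + word_wt (slide lam s) + v) -
    (lam + word_wt (slide lam s))).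
Proof. by rewrite -cats1 slide_cat /= cats1. Qed.

(** The local rule of jeu de taquin is a sequence of raisings.  By induction on
    the last letter: the chain for the shorter word also applies to the longer
    one, and it is prolonged within the stabiliser of the weight reached. *)
Lemma slide_raises om s : mword (om :: s) -> highest (om :: s) ->
  exists mu, raises s om (slide 0 s) mu /\ highest (slide 0 s).
Proof.
elim/last_ind: s => [|s v IH].
  by move=> _ _; exists om; split=> //; apply: raises_refl.
rewrite -rcons_cons -cats1 => m h.
have [ms mv] := proj1 (mword_cat _ _ _) m.
have hs := highest_prefix m h; have [mu [c hc]] := IH ms hs.
have [omm mss] := proj1 (mword_cons _ _ _) ms.
have [vm _] := proj1 (mword_cons _ _ _) mv.
have [cn mm w] := raises_invariants c mss omm.
have dk := proj2 (highest_dominant ms hs).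
have dkv := proj2 (highest_dominant m h).
rewrite word_wt_cat word_wt1 word_wt_cons in dkv; rewrite word_wt_cons in dk.
have mr : mword (slide 0 s) by apply/(wconn_mword cn).
have [|nu [c' hc']] := raises_last mr hc mm vm; first by rewrite -w.
exists nu; rewrite slide_rcons add0r; split=> //.
by apply: raises_trans c'; apply: raises_rcons.
Qed.

Lemma slide_wconn om s : mword (om :: s) -> highest (om :: s) ->
  wconn s (slide 0 s) /\ highest (slide 0 s).
Proof.
move=> m h; have [mu [c hc]] := slide_raises m h.
have [omm ms] := proj1 (mword_cons _ _ _) m.
by have [] := raises_invariants c ms omm.
Qed.

(** Induction on the number of columns.  Write x a for the first word, with a
    letter a, and let om g be the commutor of x and a.  Since om g p is highest,
    [slide_wconn] connects g p with x q, where q is the column to the left of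
    p.  The commutor z of x a and p is connected with
      eta p ++ eta (x a) = eta p ++ eta g ++ eta om
    by [flip_wcommutor], so without its last letter z is the highest word of the
    component of eta p ++ eta g, and hence of eta q ++ eta x: it is the
    commutor of x and q, to which the induction hypothesis applies.  The last
    letter is determined by the weight. *)
Lemma wcommutor_jdt x p (L : nat -> nat -> V) : mword x -> mword p ->
  highest (x ++ p) ->
  (forall j, (j <= size x)%N -> L 0%N j = word_wt (take j x)) ->
  (forall i, (i <= size p)%N -> L i (size x) = word_wt x + word_wt (take i p)) ->
  (forall i j, (i < size p)%N -> (j < size x)%N ->
     L i.+1 j = domW Phi (L i j + L i.+1 j.+1 - L i j.+1)) ->
  forall j, (j <= size x)%N ->
    word_wt (take (size p + j) (wcommutor x p)) = L (size p) j.
Proof.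
elim/last_ind: x p => [|x a IH] p mx mp hxp L0 Ll Lr j.
  rewrite leqn0 => /eqP ->; rewrite addn0 /wcommutor.
  have -> : etaw [::] = [::] by apply/size0nil; rewrite etaw_size.
  by rewrite cats0 etawK // take_size Ll // take_size word_wt_nil add0r.
have mxa := mx; rewrite -cats1 in mxa.
have [mx' ma] := proj1 (mword_cat _ _ _) mxa.
have mxp : mword (rcons x a ++ p) by apply/mword_cat.
have hx := highest_prefix mxp hxp.
have hxa := hx; rewrite -cats1 in hxa.
have hx' := highest_prefix mxa hxa.
have mu := wcommutor_mword mx' ma; have hu := wcommutor_highest mx' ma hxa.
have wu := wcommutor_wt mx' ma; have fu := flip_wcommutor mx' ma hxa.
have cu := wcommutor_wconn mx' ma; have := wcommutor_size mx' ma.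
move: mu hu wu fu cu; case: (wcommutor x [:: a]) => [|om g] mu hu wu fu cu.
  by rewrite addn1.
rewrite addn1 => -[sg].
have [omm mg] := proj1 (mword_cons _ _ _) mu.
have [_ xg] : wconn (etaw [:: a]) [:: om] /\ wconn (etaw x) g.
  by apply: (wconn_split (s1 := etaw [:: a]) (t1 := [:: om])) => //; rewrite etaw_size.
have gx : wconn g x by apply/wconn_sym; apply: wconn_trans xg; apply: wconn_etaw.
(* The slide of g is highest and connected to x. *)
have sgx : slide 0 g = x.
  have [gs hs] := slide_wconn mu hu.
  apply: (highest_unique C) => //; first by apply/(wconn_mword gs).
  by apply: wconn_trans gx; apply: wconn_sym.
have hup : highest ((om :: g) ++ p).
  by apply: (highest_change_prefix mxp) => //; rewrite wu cats1.
have mup : mword ((om :: g) ++ p) by apply/mword_cat.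
have [gps hs] := slide_wconn (om := om) (s := g ++ p) mup hup.
rewrite slide_cat sgx add0r in gps hs.
set q := slide _ p in gps hs.
have mgp : mword (g ++ p) by apply/mword_cat.
have mxq : mword (x ++ q) by apply/(wconn_mword gps).
have [_ mq] := proj1 (mword_cat _ _ _) mxq.
have sq : size q = size p by apply: slide_size.
have mxp' : mword x /\ mword p by [].
have szx : size (rcons x a) = (size x).+1 by rewrite size_rcons.
rewrite szx in L0 Ll Lr *.
have qL i : (i <= size q)%N -> L i (size x) = word_wt x + word_wt (take i q).
  elim: i => [|i IHi] iq.
    by rewrite L0 // take0 word_wt_nil addr0 -cats1 take_size_cat.
  rewrite Lr -?sq // slide_partial -?sq // -IHi; last exact: ltnW.
  congr domW; rewrite -addrA; congr (_ + _).
  rewrite !Ll -?sq //; last exact: ltnW.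
  rewrite (take_nth 0) -?sq // -[rcons (take _ _) _]cats1 word_wt_cat word_wt1.
  by rewrite addrA [_ + p`_i]addrC addrK.
have {}IH := IH q mx' mq hs _ qL.
have szz := wcommutor_size mx mp.
have hz := wcommutor_highest mx mp hxp; have mz := wcommutor_mword mx mp.
have cz := wcommutor_wconn mx mp; have wz := wcommutor_wt mx mp.
set z := wcommutor _ _ in szz hz mz cz wz *.
have fg : etaw (rcons x a) = etaw g ++ etaw [:: om].
  by rewrite -cats1 -fu /flip /= drop0 take0.
have tz : take (size p + size x) z = wcommutor x q.
  have mt : mword (take (size p + size x) z).
    by move: mz; rewrite -{1}(cat_take_drop (size p + size x) z) => /mword_cat[].
  apply: (highest_unique C) => //.
  - move: hz mz; rewrite -{1 2}(cat_take_drop (size p + size x) z) => hz mz.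
    exact: highest_prefix mz hz.
  - exact: wcommutor_highest.
  apply: (wconn_trans _ (wcommutor_wconn mx' mq)).
  have := wconn_take (size p + size x) cz; rewrite fg catA take_size_cat; last first.
    by rewrite size_cat !etaw_size // sg.
  move/wconn_sym/wconn_trans; apply.
  rewrite -(flip_cat C eta g p) -(flip_cat C eta x q) sg.
  by apply: (flip_wconn Heta) => //; rewrite size_cat sg leq_addr.
rewrite leq_eqVlt => /orP[/eqP ->|]; last rewrite ltnS => jx.
  rewrite take_oversize ?wz ?word_wt_cat; last by rewrite szz szx addnC.
  by rewrite Ll // take_size.
rewrite -sq -IH => [|j' j'x|i j' ip j'x|//]; last 2 first.
- by rewrite L0 ?(leq_trans j'x) // -cats1 takel_cat.
- by apply: Lr; rewrite -?sq // ltnW.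
by rewrite -tz take_takel // sq leq_add2l.
Qed.

End WordCommutor.

(** * The tensor product of many factors, by positions *)

Section WordPositions.
Context {R : realFieldType} {V : vectType R} (Phi : root_system V).
Local Notation I := 'I_(rk Phi).
Implicit Types (s t : seq V) (i : I).

(** The terms whose maximum is eps_i in the tensor product rule for many factors. *)
Definition word_term i s j : R :=
  letter_eps i s`_j - pairingi (word_wt (take j s)) i.

Lemma word_term_le i s j : (j < size s)%N -> word_term i s j <= word_eps i s.
Proof.
elim: s j => // x s IH [|j] h.
  by rewrite /word_term /= word_wt_nil pairingi0 subr0 le_max lexx.
have -> : word_term i (x :: s) j.+1 = word_term i s j - pairingi x i.
  by rewrite /word_term /= word_wt_cons pairingiD opprD addrA addrAC.
by rewrite [word_eps _ _]/= le_max lerD2r IH ?orbT.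
Qed.

Lemma word_eps_attained i s : s != [::] ->
  exists2 j, (j < size s)%N & word_eps i s = word_term i s j.
Proof.
elim: s => // x s IH _.
have t0 : word_term i (x :: s) 0 = letter_eps i x.
  by rewrite /word_term /= word_wt_nil pairingi0 subr0.
have [s0|/IH[j js e]] := eqVneq s [::].
  exists 0%N => //; rewrite t0 s0 /= max_l // sub0r.
  by rewrite /letter_eps le_max lexx orbT.
rewrite [word_eps _ _]/=.
have [le|lt] := lerP (letter_eps i x) (word_eps i s - pairingi x i).
  exists j.+1 => //; rewrite e.
  by rewrite /word_term /= word_wt_cons pairingiD opprD addrA addrAC.
by exists 0%N.
Qed.

Lemma word_eps_at i s j : (j < size s)%N ->
  (forall m, (m < size s)%N -> word_term i s m <= word_term i s j) ->
  word_eps i s = word_term i s j.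
Proof.
move=> js max; apply: le_anti; rewrite word_term_le // andbT.
have [|m ms ->] := @word_eps_attained i s; last exact: max.
by case: s js {max}.
Qed.

(** Cut the word before and after the letter at position j.  As j is the last
    index attaining the maximum, f_i acts neither before nor after it. *)
Lemma word_fop_at i s j : (j < size s)%N ->
  (forall m, (m < size s)%N -> word_term i s m <= word_term i s j) ->
  (forall m, (m < size s)%N -> word_term i s m = word_term i s j -> (m <= j)%N) ->
  word_fop i s = omap (set_nth 0 s j) (letter_fop i s`_j).
Proof.
move=> js max last; have es := word_eps_at js max.
have setE y : set_nth 0 s j y = take j s ++ y :: drop j.+1 s.
  by rewrite set_nthE js.
have sE := cat_take_drop j s; rewrite (drop_nth 0 js) in sE.
set x := s`_j in setE sE es *; set s1 := take j s in setE sE es *.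
set s2 := drop j.+1 s in setE sE es *.
have s1sz : size s1 = j by rewrite size_takel // ltnW.
have eM : word_term i s j = letter_eps i x - pairingi (word_wt s1) i by [].
have le1 : word_eps i s1 <= word_eps i (x :: s2) - pairingi (word_wt s1) i.
  have h : word_eps i s1 <= word_eps i s by rewrite -sE word_eps_cat le_max lexx.
  apply: le_trans h _; rewrite es eM lerD2r [word_eps _ _]/= le_max lexx //.
rewrite -{1}sE word_fop_cat le1 [word_fop i (x :: s2)]/=.
have lt2 : letter_eps i x <= word_eps i s2 - pairingi x i ->
    s2 = [::] /\ letter_fop i x = None.
  have [-> |s20] := eqVneq s2 [::].
    (* The empty word wins the comparison when the letter has eps_i = - wt_i, but
       then f_i does not act on this letter either. *)
    rewrite /= sub0r /letter_eps ge_max lexx andbT /letter_fop => h; split=> //.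
    by case: eqP => // x1; move: h; rewrite x1 oppr_ge0 ler10.
  have [m ms ->] := word_eps_attained i s20; rewrite leNgt => /negP[].
  have tm : word_term i s (j.+1 + m) =
      word_term i s2 m - pairingi x i - pairingi (word_wt s1) i.
    rewrite /word_term -sE nth_cat s1sz ltnNge leqW ?leq_addr //=.
    rewrite subSn ?leq_addr // addKn /=.
    rewrite take_cat s1sz ltnNge leqW ?leq_addr //= subSn ?leq_addr // addKn /=.
    by rewrite word_wt_cat word_wt_cons !pairingiD; lra.
  have lts : (j.+1 + m < size s)%N.
    by rewrite -sE size_cat s1sz /= addSnnS ltn_add2l ltnS.
  have := max _ lts; rewrite le_eqVlt => /orP[/eqP /(last _ lts)|].
    by rewrite addSn leqNgt ltnS leq_addr.
  by rewrite tm eM; lra.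
case: ifP => [/lt2[-> ->] //|_].
by case: (letter_fop i x) => //= y; rewrite setE.
Qed.

Lemma word_eop_at i s j : (j < size s)%N ->
  (forall m, (m < size s)%N -> word_term i s m <= word_term i s j) ->
  (forall m, (m < size s)%N -> word_term i s m = word_term i s j -> (j <= m)%N) ->
  word_eop i s = omap (set_nth 0 s j) (letter_eop i s`_j).
Proof.
move=> js max first; have es := word_eps_at js max.
have setE y : set_nth 0 s j y = take j s ++ y :: drop j.+1 s.
  by rewrite set_nthE js.
have sE := cat_take_drop j s; rewrite (drop_nth 0 js) in sE.
set x := s`_j in setE sE es *; set s1 := take j s in setE sE es *.
set s2 := drop j.+1 s in setE sE es *.
have s1sz : size s1 = j by rewrite size_takel // ltnW.
have eM : word_term i s j = letter_eps i x - pairingi (word_wt s1) i by [].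
have le2 : word_eps i s2 - pairingi x i <= letter_eps i x.
  have h : word_eps i (x :: s2) - pairingi (word_wt s1) i <= word_eps i s.
    by rewrite -sE word_eps_cat le_max lexx orbT.
  by move: h; rewrite es eM lerD2r [word_eps _ _]/= ge_max => /andP[].
have -> : word_eop i s = omap (cat s1) (word_eop i (x :: s2)).
  rewrite -sE; have [-> |s10] := eqVneq s1 [::]; first by case: word_eop.
  rewrite word_eop_cat; case: ifP => // le1.
  have [m ms e1] := word_eps_attained i s10.
  have mj : (m < j)%N by rewrite -s1sz.
  have lts : (m < size s)%N := ltn_trans mj js.
  have tm : word_term i s m = word_term i s1 m.
    by rewrite /word_term /s1 nth_take // take_takel // ltnW.
  have : word_term i s m = word_term i s j.
    apply: le_anti; rewrite max //= tm -e1; apply: le_trans le1.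
    by rewrite eM lerD2r [word_eps _ _]/= le_max lexx.
  by move/(first _ lts); rewrite leqNgt mj.
rewrite [word_eop i (x :: s2)]/= le2.
by case: (letter_eop i x) => //= y; rewrite setE.
Qed.

End WordPositions.

Section PathWords.
Context {R : realFieldType} {V : vectType R} {Phi : root_system V}.
Local Notation I := 'I_(rk Phi).
Local Notation alpha := (simple Phi).
Local Notation words := (words Phi).

Definition ord_word n (y : 'I_n -> V) : seq V := [seq y i | i <- enum 'I_n].

Lemma ord_word_size n (y : 'I_n -> V) : size (ord_word y) = n.
Proof. by rewrite size_map size_enum_ord. Qed.

Lemma ord_word_nth n (y : 'I_n -> V) (i : 'I_n) : (ord_word y)`_i = y i.
Proof. by rewrite (nth_map i) ?size_enum_ord // nth_ord_enum. Qed.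

Lemma ord_word_take n (y : 'I_n -> V) j : (j <= n)%N ->
  word_wt (take j (ord_word y)) = partial_sum y j.
Proof.
move=> jn; rewrite /word_wt /partial_sum.
transitivity (\sum_(m < n | (m < j)%N) (ord_word y)`_m); last first.
  by apply: eq_bigr => m _; rewrite ord_word_nth.
rewrite (big_nth 0) size_takel ?ord_word_size // big_mkord.
rewrite (big_ord_widen n (fun m => (take j (ord_word y))`_m)) //.
by apply: eq_bigr => m mj; rewrite nth_take.
Qed.

Lemma ord_word_mem n (y : 'I_n -> V) x : x \in ord_word y -> exists i, x = y i.
Proof. by case/mapP => i _ ->; exists i. Qed.

Section Letters.
Variable lam : V.
Implicit Type mu : minuscule_crystal (Phi := Phi) lam.

Lemma minuscule_crystal_epsi i mu : epsi i mu = letter_eps i (val mu).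
Proof. exact: fund_sum_pairing. Qed.

Lemma minuscule_crystal_fop i mu : omap val (fop i mu) = letter_fop i (val mu).
Proof.
rewrite /= /letter_fop; case: eqP => // x1.
rewrite insubT //; apply/asboolP.
have -> : val mu - alpha i = refl i (val mu) by rewrite /refl x1 scale1r.
by apply: in_orbit_refl; apply/asboolP; case: mu {x1}.
Qed.

Lemma minuscule_crystal_eop i mu : omap val (eop i mu) = letter_eop i (val mu).
Proof.
rewrite /= /letter_eop; case: eqP => // x1.
rewrite insubT //; apply/asboolP.
have -> : val mu + alpha i = refl i (val mu) by rewrite /refl x1 scaleN1r opprK.
by apply: in_orbit_refl; apply/asboolP; case: mu {x1}.
Qed.

End Letters.

Section Tensor.
Variables (n : nat) (x : 'I_n -> V).
Local Notation T := (minuscule_tensor (Phi := Phi) x).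
Implicit Types (a : T) (i : I).

Definition tensor_word a : words := ord_word (fun j => val (a j)).

Lemma tensor_word_size a : size (tensor_word a) = n.
Proof. exact: ord_word_size. Qed.

Lemma tensor_word_term i a (j : 'I_n) :
  tensor_term i a j = word_term i (tensor_word a) j.
Proof.
rewrite /tensor_term /word_term ord_word_nth minuscule_crystal_epsi; congr (_ - _).
rewrite ord_word_take ?(ltnW (ltn_ord j)) // /partial_sum pairingi_sum.
by apply: eq_bigr.
Qed.

Lemma tensor_attains_max i a j : tensor_attains i a j ->
  forall m, (m < n)%N ->
    word_term i (tensor_word a) m <= word_term i (tensor_word a) j.
Proof.
move=> /forallP h m mn.
by have := h (Ordinal mn); rewrite !tensor_word_term.
Qed.

Lemma tensor_attains_ex i a : (0 < n)%N -> exists j, tensor_attains i a j.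
Proof.
move=> n0; have [|j jn e] := @word_eps_attained _ _ _ i (tensor_word a).
  by rewrite -size_eq0 tensor_word_size -lt0n.
rewrite tensor_word_size in jn; exists (Ordinal jn); apply/forallP => m.
by rewrite !tensor_word_term /= -e word_term_le // tensor_word_size.
Qed.

Lemma tensor_word_set a (j : 'I_n) (y : minuscule_crystal (domW Phi (x j))) :
  tensor_word (dfwith a y) = set_nth 0 (tensor_word a) j (val y).
Proof.
apply: (eq_from_nth (x0 := 0)) => [|m].
  by rewrite size_set_nth !tensor_word_size; apply/esym/maxn_idPr.
rewrite tensor_word_size => mn; rewrite -[m]/(nat_of_ord (Ordinal mn)).
move: (Ordinal mn) => m'; rewrite nth_set_nth ord_word_nth /=.
have [jm|jm] := eqVneq j m'; first by rewrite -{m'}jm dfwith_in eqxx.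
rewrite dfwith_out // ord_word_nth.
by rewrite -[(m' == j :> nat)]/(m' == j) eq_sym (negPf jm).
Qed.

Lemma tensor_word_fop i a : word_fop i (tensor_word a) = omap tensor_word (fop i a).
Proof.
have -> : fop i a = obind (fun j => omap (fun z => dfwith a z) (fop i (a j)))
    (tensor_last i a) by [].
rewrite /tensor_last; case: pickP => [j /andP[aj /forallP jl]|none].
  rewrite (word_fop_at (j := j)) ?tensor_word_size //.
  - rewrite ord_word_nth -minuscule_crystal_fop.
    rewrite -[obind _ (Some j)]/(omap (fun z => dfwith a z) (fop i (a j))).
    by case: (fop i (a j)) => // y; congr Some; rewrite tensor_word_set.
  - exact: tensor_attains_max.
  move=> m mn e; apply: (implyP (jl (Ordinal mn))).
  apply/forallP => m'; rewrite !tensor_word_term /= e.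
  exact: tensor_attains_max.
have [n0|] := posnP n.
  suff -> : tensor_word a = [::] by [].
  by apply: size0nil; rewrite tensor_word_size.
case/(tensor_attains_ex i a) => j0 aj0.
have [j aj jmax] := arg_maxnP (fun j : 'I_n => val j) aj0.
have := none j; rewrite aj /= => /negbT /forallP[] m.
by apply/implyP => /jmax.
Qed.

Lemma tensor_first_spec i a : (0 < n)%N -> exists j,
  [/\ tensor_first i a = Some j, tensor_attains i a j
    & forall m, tensor_attains i a m -> (j <= m)%N].
Proof.
move=> n0; rewrite /tensor_first; case: pickP => [j /andP[aj /forallP jl]|none] /=.
  by exists j; split=> // m /(implyP (jl m)).
have [j0 aj0] := tensor_attains_ex i a n0.
have [j aj jmin] := arg_minnP (fun j : 'I_n => val j) aj0.
have := none j; rewrite aj /= => /negbT /forallP[] m.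
by apply/implyP => /jmin.
Qed.

Lemma tensor_word_eop i a : word_eop i (tensor_word a) = omap tensor_word (eop i a).
Proof.
have [n0|n0] := posnP n.
  have -> : tensor_word a = [::] by apply: size0nil; rewrite tensor_word_size.
  by rewrite /=; case: (tensor_first i a) => [[j jn]|] //; exfalso; rewrite n0 in jn.
have -> : eop i a = obind (fun j => omap (fun z => dfwith a z) (eop i (a j)))
    (tensor_first i a) by [].
have [j [-> aj jl]] := tensor_first_spec i a n0.
rewrite (word_eop_at (j := j)) ?tensor_word_size //.
- rewrite ord_word_nth -minuscule_crystal_eop.
  rewrite -[obind _ (Some j)]/(omap (fun z => dfwith a z) (eop i (a j))).
  by case: (eop i (a j)) => // y; congr Some; rewrite tensor_word_set.
- exact: tensor_attains_max.
move=> m mn e; apply: (jl (Ordinal mn)).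
apply/forallP => m'; rewrite !tensor_word_term /= e.
exact: tensor_attains_max.
Qed.

Lemma tensor_word_eps i a : word_eps i (tensor_word a) = tensor_eps i a.
Proof.
rewrite /tensor_eps; have [n0|n0] := posnP n.
  have -> : tensor_word a = [::] by apply: size0nil; rewrite tensor_word_size.
  by rewrite /=; case: (tensor_first i a) => [[j jn]|] //; exfalso; rewrite n0 in jn.
have [j [-> aj _]] := tensor_first_spec i a n0.
rewrite /= tensor_word_term; apply: word_eps_at; rewrite tensor_word_size //.
exact: tensor_attains_max.
Qed.

Lemma tensor_word_inclusion : crystal_inclusion tensor_word.
Proof.
split; last first.
  move=> a b e; apply: functional_extensionality_dep => j; apply: val_inj.
  by have := congr1 (fun s => s`_j) e; rewrite !ord_word_nth.
split=> [a|a|i a|i a].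
- by rewrite /= /word_wt big_map big_enum.
- by apply: eq_bigr => i _; rewrite tensor_word_eps.
- exact: tensor_word_fop.
- exact: tensor_word_eop.
Qed.

End Tensor.

(** Dominant partial sums make every term of the tensor product rule at most 0. *)
Lemma dominant_path_highest (C : gcrystal_category Phi) s : mword Phi s ->
  (forall j i, (j <= size s)%N -> 0 <= pairingi (word_wt (take j s)) (i : I)) ->
  @highest R V Phi s.
Proof.
move=> ms ds; apply: (eps_highest C) => // i.
have [->//|s0] := eqVneq s [::].
have [j js ->] := word_eps_attained i s0.
have := ds j i (ltnW js); have := ds j.+1 i js.
rewrite (take_nth 0) // -cats1 word_wt_cat word_wt1 pairingiD => h1 h2.
by rewrite subr_le0 ge_max h2 /=; lra.
Qed.

End PathWords.

(** * Path crystals as components of the words *)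

Section PathCrystals.
Context {R : realFieldType} {V : vectType R} {Phi : root_system V}.
Context (C : gcrystal_category Phi).
Local Notation I := 'I_(rk Phi).
Local Notation words := (words Phi).
Local Notation wconn := (@wconn R V Phi).

Lemma morphism_connected (A : crystal Phi) (u : A -> words) a b :
  crystal_inclusion u -> connected a b -> wconn (u a) (u b).
Proof.
move=> ui; elim=> {a b} [a b [i f]|a|a b _ h|a b c _ h _ h'].
- by apply: wconn_sym; apply: (wconn_fop (i := i)); rewrite (image_fop ui) f.
- exact: wconn_refl.
- exact: wconn_sym.
- exact: wconn_trans h h'.
Qed.

(** The component of a word with minuscule letters is the image of an irreducible
    crystal, so a crystal that embeds with the same image is isomorphic to
    it. *)
Lemma gobj_of_word_component (K : crystal Phi) (u : K -> words) (k0 : K) :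
  crystal_inclusion u -> mword Phi (u k0) ->
  (forall k, wconn (u k0) (u k)) ->
  (forall s, wconn (u k0) s -> exists k, u k = s) -> gobj C K.
Proof.
move=> ui m0 conn onto.
have [lam [m [b0 [dl mi mb0]]]] := mword_embedded C m0.
have hP k : exists b, m b = u k.
  by apply: (wconn_image C (conn k) m0 mi); exists b0.
have gP b : exists k, u k = m b.
  apply: onto; rewrite -mb0; have [t [tm _]] := exists_top C dl.
  apply: (wconn_trans (image_wconn mi (tm b0))).
  exact/wconn_sym/image_wconn.
have [h hE] := choice hP; have [g gE] := choice gP.
have [[mw me mf mE] minj] := mi; have [[uw ue uf uE] uinj] := ui.
apply/g_objects; exists 1%N, (fun=> lam); split=> //.
exists (fun k => existT _ ord0 (h k)); split.
  split=> [k|k|i k|i k] /=; rewrite -?mw -?me ?hE //.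
    suff -> : fop i (h k) = omap h (fop i k) by case: (fop i k).
    apply: (inj_omap minj); rewrite -mf hE uf.
    by case: (fop i k) => //= k'; rewrite hE.
  suff -> : eop i (h k) = omap h (eop i k) by case: (eop i k).
  apply: (inj_omap minj); rewrite -mE hE uE.
  by case: (eop i k) => //= k'; rewrite hE.
exists (fun x : dsum _ => g (projT2 x)) => [k|[j b]] /=.
  by apply: uinj; rewrite gE hE.
rewrite [j]ord1; congr existT; apply: minj.
by rewrite hE gE.
Qed.

Section Path.
Variables (n : nat) (x : 'I_n -> V).
Hypothesis mx : forall i, minuscule Phi (domW Phi (x i)).
Local Notation K := (path_crystal (Phi := Phi) x).
Local Notation T := (minuscule_tensor (Phi := Phi) x).

Lemma tensor_mword (a : T) : mword Phi (tensor_word a).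
Proof.
move=> y /ord_word_mem [i ->].
by apply: orbit_minuscule (mx i) _; apply/asboolP; case: (a i).
Qed.

Definition path_word (k : K) : words := tensor_word (val k).

Lemma tensor_eopK i (a a' : T) : eop i a = Some a' -> fop i a' = Some a.
Proof.
move=> e; have ti := tensor_word_inclusion (Phi := Phi) x.
have := image_eop ti i a; rewrite e => /(word_eopK C (@tensor_mword a)).
rewrite (image_fop ti); case: (fop i a') => // b [e'].
by congr Some; apply: (proj2 ti _ _ e').
Qed.

Lemma path_word_inclusion : crystal_inclusion path_word.
Proof.
have ti := tensor_word_inclusion (Phi := Phi) x.
split; last by move=> k k' /(proj2 ti) /val_inj.
case: (ti) => -[tw te tf tE] _.
split=> [k|k|i k|i k]; rewrite ?tw ?te ?tf ?tE //.
  have -> : fop i k = obind (fun b => insub b : option K) (fop i (val k)) by [].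
  case E: (fop i (val k)) => [b|] //; rewrite -[obind _ _]/(insub b : option K).
  rewrite insubT //; apply/asboolP; apply: rst_trans.
    by apply/asboolP; apply: (svalP k).
  by apply: rst_sym; apply: rst_step; exists i.
have -> : eop i k = obind (fun b => insub b : option K) (eop i (val k)) by [].
  case E: (eop i (val k)) => [b|] //; rewrite -[obind _ _]/(insub b : option K).
rewrite insubT //; apply/asboolP; apply: rst_trans.
  by apply/asboolP; apply: (svalP k).
by apply: rst_step; exists i; apply: tensor_eopK.
Qed.

Lemma path_mword k : mword Phi (path_word k).
Proof. exact: tensor_mword. Qed.

Lemma path_word_conn k : wconn (path_word (path_top x)) (path_word k).
Proof.
apply: (morphism_connected (tensor_word_inclusion x)).
by apply/asboolP; apply: (svalP k).
Qed.

Lemma path_gobj : gobj C K.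
Proof.
apply: (gobj_of_word_component path_word_inclusion (@path_mword _)).
  exact: path_word_conn.
move=> s h; apply: (wconn_image C h (@path_mword _) path_word_inclusion).
by exists (path_top x).
Qed.

End Path.

Context (eta : forall B : crystal Phi, B -> B) (Heta : lusztig_involution C eta).

(** By the naturality of eta, the commutor can be computed in words after any
    embeddings in which the words have fixed lengths. *)
Lemma commutor_word (A B : crystal Phi) (u : A -> words) (v : B -> words) m n a b :
  gobj C A -> gobj C B -> crystal_inclusion u -> crystal_inclusion v ->
  (forall a, size (u a) = m) -> (forall b, size (v b) = n) ->
  let z := commutor eta ((a, b) : tensor2 A B) in
  v z.1 ++ u z.2 = wcommutor C eta (u a) (v b).
Proof.
move=> oA oB ui vi su sv z.
have ci := cat_inclusion vi ui sv.
rewrite /wcommutor (etaw_inclusion Heta a oA ui) (etaw_inclusion Heta b oB vi).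
by rewrite (etaw_inclusion Heta ((eta b, eta a) : tensor2 B A) (g_tensor oB oA) ci).
Qed.

End PathCrystals.

Theorem theorem4p4 (R : realFieldType) (V : vectType R) (Phi : root_system V)
    (C : gcrystal_category Phi)
    (eta : forall B : crystal Phi, B -> B) (Heta : lusztig_involution C eta)
    (l k : nat) (hl : (0 < l)%N) (hk : (0 < k)%N)
    (pi' : 'I_l -> V) (pi : 'I_k -> V)
    (dom_pi' : forall j, (1 <= j <= l)%N -> dominant Phi (partial_sum pi' j))
    (dom_pi : forall i, (1 <= i <= k)%N -> dominant Phi (partial_sum pi i))
    (min_pi' : forall j, minuscule Phi (domW Phi (pi' j)))
    (min_pi : forall i, minuscule Phi (domW Phi (pi i)))
    (p : path_crystal pi) (p' : path_crystal pi')
    (max_p : maximal (B := tensor2 (path_crystal pi') (path_crystal pi))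
               (path_top pi', p))
    (jdt_p : forall j : 'I_l,
       entry p' j = jdt Phi pi' (entry p) k j.+1 - jdt Phi pi' (entry p) k j) :
  commutor eta (path_top pi', p) = (path_top pi, p') /\
  commutor eta (path_top pi, p') = (path_top pi', p).
Proof.
pose B' := path_crystal (Phi := Phi) pi'; pose B := path_crystal (Phi := Phi) pi.
pose u' : B' -> words Phi := @path_word _ _ _ _ pi'.
pose u : B -> words Phi := @path_word _ _ _ _ pi.
have oB' : gobj C B' by apply: path_gobj.
have oB : gobj C B by apply: path_gobj.
have ui' : crystal_inclusion u' by apply: (path_word_inclusion C min_pi').
have ui : crystal_inclusion u by apply: (path_word_inclusion C min_pi).
have su' b : size (u' b) = l by apply: tensor_word_size.
have su b : size (u b) = k by apply: tensor_word_size.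
have m' b : mword Phi (u' b) by apply: path_mword.
have m b : mword Phi (u b) by apply: path_mword.
set x := u' (path_top pi'); set w := u p; set z := wcommutor C eta x w.
have hxw : highest (Phi := Phi) (x ++ w).
  move=> i; have := image_eop (cat_inclusion ui' ui su') i (path_top pi', p).
  by rewrite max_p.
have hz := wcommutor_highest Heta (m' _) (m _) hxw.
have mz := @wcommutor_mword _ _ _ C eta _ _ (m' (path_top pi')) (m p).
have cz := @wcommutor_wconn _ _ _ C eta _ _ (m' (path_top pi')) (m p).
have sz := @wcommutor_size _ _ _ C eta _ _ (m' (path_top pi')) (m p).
rewrite -/x -/w -/z su' su in hz mz cz sz.
have jz j : (j <= l)%N -> word_wt (take (k + j) z) = jdt Phi pi' (entry p) k j.
  move=> jl; have := wcommutor_jdt Heta (L := jdt Phi pi' (entry p)) (m' _) (m _) hxw.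
  rewrite -/x -/w -/z su' su; apply=> // {jl}j => [jl|jk|j' jk jl].
  - by rewrite jdt_row0 ord_word_take.
  - rewrite jdt_last -(ord_word_take _ (leqnn l)) -(ord_word_take _ jk).
    by rewrite take_oversize ?ord_word_size.
  exact: jdt_rec.
have [mtz mdz] : mword Phi (take k z) /\ mword Phi (drop k z).
  by apply/mword_cat; rewrite cat_take_drop.
(* The first k letters are the maximum of the path crystal of pi; the others are
   differences of the weights in the last row of the growth diagram. *)
have tz : take k z = u (path_top pi).
  apply: (highest_unique C) => //.
  - by apply: (highest_prefix C (t := drop k z)); rewrite cat_take_drop.
  - apply: (dominant_path_highest C) => // j i; rewrite su => jk.
    rewrite ord_word_take //; case: j jk => [|j] jk.
      by rewrite /partial_sum big_pred0 // pairingi0.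
    by case: (dom_pi j.+1 jk).
  have := wconn_take k cz.
  rewrite take_size_cat; last by rewrite (etaw_size C eta (m p)) su.
  move/wconn_sym/wconn_trans; apply; apply: wconn_sym.
  by apply: (wconn_trans (path_word_conn p)); apply/wconn_etaw/m.
have dz : drop k z = u' p'.
  apply: (eq_from_nth (x0 := 0)); first by rewrite size_drop sz su' addnK.
  move=> j; rewrite size_drop sz addnK => jl.
  have -> : (u' p')`_j = entry p' (Ordinal jl).
    exact: (ord_word_nth (entry p') (Ordinal jl)).
  rewrite jdt_p /=.
  rewrite -!jz ?(ltnW jl) // addnS (take_nth 0) ?sz ?[(l + k)%N]addnC ?ltn_add2l //.
  by rewrite -cats1 word_wt_cat word_wt1 nth_drop addrAC subrr add0r.
have uz : z = u (path_top pi) ++ u' p' by rewrite -tz -dz cat_take_drop.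
have pair_eq (A1 A2 : crystal Phi) (v1 : A1 -> words Phi) (v2 : A2 -> words Phi) n
    (c d : tensor2 A1 A2) : crystal_inclusion v1 -> crystal_inclusion v2 ->
    (forall b, size (v1 b) = n) -> v1 c.1 ++ v2 c.2 = v1 d.1 ++ v2 d.2 -> c = d.
  by move=> v1i v2i sv /(proj2 (cat_inclusion v1i v2i sv)).
split.
  apply: (pair_eq _ _ _ _ _ _ _ ui ui' su).
  by rewrite (commutor_word Heta _ _ oB' oB ui' ui su' su).
apply: (pair_eq _ _ _ _ _ _ _ ui' ui su').
rewrite (commutor_word Heta _ _ oB oB' ui ui' su su') -tz -dz.
by have := wcommutorK Heta (m' (path_top pi')) (m p) hxw; rewrite su.
Qed.
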